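(* Let $d\ge 1$, let $\sigma_Z>0$ be a fixed constant, and let $g_n$ be the privatised partitioning classification rule defined in the context, with $h_n>0$. If $$\lim_{n\to\infty}h_n=0\qquad\text{and}\qquad \lim_{n\to\infty}\frac{n h_n^{2d}}{\log n}=\infty,$$ then $g_n$ is strongly universally consistent, i.e. $$\lim_{n\to\infty}L(g_n)=L^*\quad\text{almost surely}$$ for any distribution of $(X,Y)$ on $\mathbb{R}^d\times\{-1,1\}$.
   Context: Binary classification: $(X,Y)$ is a random vector with $X\in\mathbb{R}^d$ and label $Y\in\{-1,1\}$; $m(x)=\mathbb{E}[Y\mid X=x]$. For a decision function $g:\mathbb{R}^d\to\{-1,1\}$ the error probability is $L(g)=\mathbb{P}\{g(X)\ne Y\}$. With $\mathrm{sign}(z)=1$ for $z>0$ and $\mathrm{sign}(z)=-1$ for $z\le0$, the Bayes decision rule is $g^*(x)=\mathrm{sign}\,m(x)$, which minimises the error probability, and $L^*=\mathbb{P}\{g^*(X)\neq Y\}$. For a data-dependent rule $g_n$, $L(g_n)$ is the random variable $\mathbb{P}\{g_n(X)\ne Y\mid \text{data}\}$, where $(X,Y)$ is independent of all the data and noise used to build $g_n$. The raw data $(X_1,Y_1),(X_2,Y_2),\ldots$ are i.i.d. copies of $(X,Y)$. For $h>0$, $\mathcal{P}_h=\{A_{h,1},A_{h,2},\ldots\}$ is a cubic partition of $\mathbb{R}^d$, i.e. the (Borel measurable, pairwise disjoint) cells $A_{h,j}$ are cubes of volume $h^d$. Let $S_1\subseteq S_2\subseteq\cdots$ be sets with $S_n\uparrow\mathbb{R}^d$,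 each $S_n$ being either a ball centred at the origin or all of $\mathbb{R}^d$. For each $n$, with $h=h_n$, the cells are numbered so that $A_{h,j}\cap S_n\ne\emptyset$ when $j\le N_n$ and $A_{h,j}\cap S_n=\emptyset$ when $j>N_n$, where $N_n$ is a positive integer, or $N_n=\infty$ if $S_n=\mathbb{R}^d$. Privacy mechanism: $\{\epsilon_{i,j}\}_{i,j\ge1}$ are i.i.d. with the centred, unit-variance Laplace distribution (density $x\mapsto\exp(-\sqrt2|x|)/\sqrt2$), independent of the raw data. With $h=h_n$, for $i\le n$ and $j\le N_n$, $$Z_{i,j}=Y_i\,\mathbb{I}_{\{X_i\in A_{h,j}\}}+\sigma_Z\epsilon_{i,j},\qquad \tilde\nu_n(A_{h,j})=\frac1n\sum_{i=1}^nZ_{i,j}\,\mathbb{I}_{\{j\le N_n\}}$$ (so $\tilde\nu_n(A_{h,j})=0$ when $j>N_n$), where $\mathbb{I}$ denotes an indicator. The classification rule is $$g_n(x)=\mathrm{sign}\bigl(\tilde\nu_n(A_{h_n,j})\bigr)\quad\text{when }x\in A_{h_n,j}.$$ *)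

(* Defs.v *)
From HB Require Import structures.
From mathcomp Require Import all_boot all_order all_algebra.
From mathcomp Require Import finmap.
From mathcomp Require Import all_classical all_reals all_analysis.

Set Implicit Arguments.
Unset Strict Implicit.
Unset Printing Implicit Defensive.

Import Order.TTheory GRing.Theory Num.Theory.
Import numFieldNormedType.Exports.

Local Open Scope classical_set_scope.
Local Open Scope ring_scope.

(* R^d is [d.-tuple R]: its library sigma-algebra is the one generated by the
   coordinates, i.e. the Borel sigma-algebra.  The sequences i, j = 1, 2, ...
   of the mathematical text are indexed from 0 (cell j.+1 is index j, so that
   "j <= N" becomes "j < N"). *)

Section geometry.
Context {R : realType} {d : nat}.

Definition euclid_norm (x : d.-tuple R) : R :=
  Num.sqrt (\sum_(k < d) tnth x k ^+ 2).

Definition centred_ball (S : set (d.-tuple R)) : Prop :=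
  exists2 r : R, 0 < r &
    S = [set x | euclid_norm x < r] \/ S = [set x | euclid_norm x <= r].

(* Coordinates of x in the frame with origin c and axes the rows of U. *)
Definition frame_coord (U : 'M[R]_d) (c x : d.-tuple R) (k : 'I_d) : R :=
  \sum_(l < d) U k l * (tnth x l - tnth c l).

(* A cube of volume h ^ d has side h.  It may be in general position (U is
   orthogonal; U = 1 is the axis-parallel case), and any part of its boundary
   may belong to it, since the cells of a partition cannot all be open or all
   be closed. *)
Definition is_cube (h : R) (A : set (d.-tuple R)) : Prop :=
  exists (U : 'M[R]_d) (c : d.-tuple R),
    [/\ U *m U^T = 1%:M,
        [set x | forall k, 0 < frame_coord U c x k < h] `<=` A &
        A `<=` [set x | forall k, 0 <= frame_coord U c x k <= h]].

Definition cubic_partition (h : R) (C : set (set (d.-tuple R))) : Prop :=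
  partition C id setT /\ forall A, C A -> measurable A /\ is_cube h A.

(* [Some k] is a finite number of cells, [None] is infinity. *)
Definition below (N : option nat) (j : nat) : bool :=
  if N is Some k then (j < k)%N else true.

Definition cell_count (S : set (d.-tuple R)) (A : nat -> set (d.-tuple R))
    (N : option nat) : Prop :=
  [/\ (if N is Some k then (0 < k)%N : Prop else S = setT),
      forall j, below N j -> A j `&` S !=set0 &
      forall j, ~~ below N j -> A j `&` S = set0].

End geometry.

Section probability_notions.
Local Open Scope ereal_scope.
Context {disp : measure_display} {Omega : measurableType disp} {R : realType}.
Variable P : probability Omega R.

Definition sigma_rv {disp' : measure_display} {T : measurableType disp'}
    (f : Omega -> T) : set (set Omega) :=
  preimage_set_system setT f measurable.

Definition independent (G H : set (set Omega)) : Prop :=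
  forall A B, G A -> H B -> P (A `&` B) = P A * P B.

Definition mutually_independent {I : choiceType} (G : I -> set (set Omega)) :
    Prop :=
  forall (J : {fset I}) (E : I -> set Omega), (forall i, i \in J -> G i (E i)) ->
    P (\bigcap_(i in [set` J]) E i) = \prod_(i <- J) P (E i).

(* L is a version of the conditional probability of E given G. *)
Definition is_cond_prob (G : set (set Omega)) (E : set Omega) (L : Omega -> R) :
    Prop :=
  [/\ forall V, measurable V -> G (L @^-1` V),
      P.-integrable setT (EFin \o L) &
      forall A, G A -> \int[P]_(w in A) (L w)%:E = P (A `&` E)].

(* m is a version of x |-> E[Y | X = x]. *)
Definition is_regression {disp' : measure_display} {T : measurableType disp'}
    (X : Omega -> T) (Y : Omega -> R) (m : T -> R) : Prop :=
  [/\ measurable_fun setT m,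
      P.-integrable setT (EFin \o (m \o X)) &
      forall B, measurable B ->
        \int[P]_(w in X @^-1` B) (m (X w))%:E = \int[P]_(w in X @^-1` B) (Y w)%:E].

Definition error_prob {T : Type} (X : Omega -> T) (Y : Omega -> R) (g : T -> R) :
    R :=
  fine (P [set w | g (X w) != Y w]).

End probability_notions.

Definition laplace_pdf {R : realType} (x : R) : R :=
  expR (- (Num.sqrt 2 * `|x|)) / Num.sqrt 2.

Definition laplace_prob {R : realType} (V : set (measurableTypeR R)) : \bar R :=
  (\int[lebesgue_measure]_(x in V) (laplace_pdf x)%:E)%E.

Definition sign_pm {R : realType} (z : R) : R := if 0 < z then 1 else -1.

Section classifier.
Context {R : realType} {d : nat} {Omega : Type}.
Variables (X : nat -> Omega -> d.-tuple R) (Y : nat -> Omega -> R).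
Variables (eps : nat -> nat -> Omega -> R) (sigmaZ : R).
Variables (A : nat -> set (d.-tuple R)) (N : option nat).

Definition privatised (i j : nat) (w : Omega) : R :=
  Y i w * \1_(A j) (X i w) + sigmaZ * eps i j w.

Definition nu_tilde (n j : nat) (w : Omega) : R :=
  n%:R^-1 * \sum_(i < n) privatised i j w * (below N j)%:R.

Definition classifier (n : nat) (w : Omega) (x : d.-tuple R) : R :=
  sign_pm (nu_tilde n (pblock_index setT A x) w).

End classifier.

Section sigma_algebras.
Context {R : realType} {d : nat}.
Context {disp : measure_display} {Omega : measurableType disp}.
Variables (X : nat -> Omega -> d.-tuple R) (Y : nat -> Omega -> R).
Variable (eps : nat -> nat -> Omega -> R).

Definition sigma_raw (i : nat) : set (set Omega) :=
  sigma_rv (fun w => (X i w, Y i w)).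

Definition sigma_noise (ij : nat * nat) : set (set Omega) :=
  sigma_rv (eps ij.1 ij.2).

(* Generated by the raw data in I and the noise variables in J. *)
Definition sigma_data (I : set nat) (J : set (nat * nat)) : set (set Omega) :=
  <<s (\bigcup_(i in I) sigma_raw i) `|` (\bigcup_(ij in J) sigma_noise ij) >>.

End sigma_algebras.

(* Main.v *)
Require Import Defs.
From HB Require Import structures.
From mathcomp Require Import all_boot all_order all_algebra.
From mathcomp Require Import finmap.
From mathcomp Require Import all_classical all_reals all_analysis.
From mathcomp Require Import measurable_realfun.
From mathcomp Require Import ring lra.

Set Implicit Arguments.
Unset Strict Implicit.
Unset Printing Implicit Defensive.

Import Order.TTheory GRing.Theory Num.Theory.
Import numFieldNormedType.Exports.

Local Open Scope classical_set_scope.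
Local Open Scope ring_scope.

(** Write [nu B = E (Y 1_B(X))] for the signed measure of the labels ([signed_mean]
on indicators). A rule that answers [1] exactly on [G] errs with probability
[P (Y = 1) - nu G], and [nu G] is largest for [D = [set x | 0 < m x]], because
[nu] has density [m] with respect to the law of [X] ([error_prob_signed_mean],
[bayes_optimal]). Hence the error probability with the data frozen is at least
the Bayes error, and the theorem says that [nu D - nu G_n] tends to 0 almost
surely, where [G_n] is the union of the cells whose noisy mass [nu_tilde] is
positive.

Fix [del > 0]. The Borel set [D] is approximated, up to [del] in the mean, by a
uniformly continuous [f] with values in the unit interval
([approximable_measurable]). When [h] is small, [f] is nearly constant on cells,
and outside a large ball there is little mass; so [nu D] is almost
[sum_j c_j nu A_j], where [c_j] is a value of [f] on the cell [A_j] and [j] runs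
over the cells meeting the ball. On one cell, deciding by the sign of
[nu_tilde A_j] loses at most [|nu_tilde A_j - nu A_j|] against the weight [c_j].
So [nu D - nu G_n] is at most a multiple of [del] plus the sum of these
deviations ([plug_in_comparison]).

A ball meets at most [M / h ^ d] cells ([packing]), so it suffices that each
deviation is at most [(del / M) h ^ d]. Averages of labels and averages of
Laplace noise satisfy Chernoff's bound: a deviation [t] of [nu_tilde] has
probability at most [4 exp (- a n t ^ 2)] ([nu_tilde_deviation]). With [t] of
order [h ^ d] the exponent is of order [n h ^ (2 d)], which dominates [ln n]; the
union bound over the cells is then summable in [n] and Borel-Cantelli applies
([cells_deviation]). The sets [S_n] eventually contain the ball, so that all
these cells do receive an estimate.

It remains to identify the given version [L n] of the conditional error
probability. As the test pair is independent of the data, freezing the data in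
the error probability gives another version ([error_prob_is_cond_prob]), and two
versions agree almost surely ([cond_prob_unique]). *)

(** * Geometry of cubes *)

Section cubes.
Context {R : realType} {d : nat}.
Implicit Types (x y c p : d.-tuple R) (U : 'M[R]_d).

Definition sqdist x y : R := \sum_(k < d) (tnth y k - tnth x k) ^+ 2.

Lemma frame_coordB U c p x k :
  frame_coord U c x k - frame_coord U c p k = frame_coord U p x k.
Proof.
rewrite /frame_coord -sumrB; apply: eq_bigr => l _.
by rewrite -mulrBr opprB addrA subrK.
Qed.

Lemma sqdist_frame_coord U c x : U *m U^T = 1%:M ->
  \sum_(k < d) frame_coord U c x k ^+ 2 = sqdist c x.
Proof.
move=> /mulmx1C UU; pose v : 'cV[R]_d := \col_l (tnth x l - tnth c l).
have sumsq (u : 'cV[R]_d) : \sum_k u k 0 ^+ 2 = (u^T *m u) 0 0.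
  by rewrite mxE; apply: eq_bigr => k _; rewrite mxE expr2.
transitivity (\sum_k (U *m v) k 0 ^+ 2).
  apply: eq_bigr => k _; rewrite mxE; congr (_ ^+ 2).
  by apply: eq_bigr => l _; rewrite mxE.
rewrite sumsq trmx_mul mulmxA -(mulmxA v^T) UU mulmx1 -sumsq.
by apply: eq_bigr => l _; rewrite mxE.
Qed.

Lemma frame_centre U c (h : R) : U *m U^T = 1%:M ->
  exists p, forall k, frame_coord U c p k = h / 2.
Proof.
move=> UU; exists [tuple tnth c l + (\sum_j U j l) * (h / 2) | l < d] => k.
rewrite /frame_coord; under eq_bigr => l _.
  rewrite tnth_mktuple addrAC subrr add0r mulrA mulr_sumr; over.
rewrite -mulr_suml exchange_big/= (bigD1 k)//= [X in _ + X]big1 ?addr0.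
  have := congr1 (fun M : 'M[R]_d => M k k) UU; rewrite !mxE eqxx/= => e.
  by under eq_bigr do rewrite -[in X in _ * X](mxE trmx_key (fun i j => U j i)); rewrite e mul1r.
move=> j jk; have := congr1 (fun M : 'M[R]_d => M k j) UU.
rewrite !mxE eq_sym (negbTE jk)/= => e.
by under eq_bigr do rewrite -[in X in _ * X](mxE trmx_key (fun i j => U j i)).
Qed.

(** The orientation of a cube is arbitrary and may change from cell to cell of a
partition. Its inscribed and circumscribed balls are all that is used of it. *)
Lemma cube_between_balls (h : R) (A : set (d.-tuple R)) : 0 < h ->
  is_cube h A ->
  exists p, (forall x, sqdist p x < (h / 2) ^+ 2 -> A x) /\
            (forall x, A x -> sqdist p x <= d%:R * (h / 2) ^+ 2).
Proof.
move=> h0 [U [c [UU intA Asub]]]; have [p pE] := frame_centre c h UU.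
exists p; split => x.
  rewrite -(sqdist_frame_coord _ _ UU) => px; apply: intA => k.
  have {px} : (frame_coord U c x k - h / 2) ^+ 2 < (h / 2) ^+ 2.
    rewrite -(pE k) frame_coordB (pE k); apply: le_lt_trans px.
    by rewrite (bigD1 k)//= lerDl sumr_ge0// => j _; exact: sqr_ge0.
  move: (frame_coord U c x k) => a; clear -h0 => ah.
  by apply/andP; split; rewrite ltNge; apply/negP => a0; nra.
move=> /Asub/= Ax; rewrite -(sqdist_frame_coord _ _ UU).
rewrite -[d in d%:R]card_ord -sum1_card natr_sum mulr_suml ler_sum// => k _.
rewrite -(frame_coordB _ c) pE mul1r.
have := Ax k; move: (frame_coord U c x k) => a; clear -h0 => /andP[].
by nra.
Qed.

(** If the centres were closer than [h], their midpoint would lie in both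
inscribed balls, hence in both cells. *)
Lemma cube_separation (h : R) (A A' : set (d.-tuple R)) p p' : 0 < h ->
  (forall x, sqdist p x < (h / 2) ^+ 2 -> A x) ->
  (forall x, sqdist p' x < (h / 2) ^+ 2 -> A' x) ->
  A `&` A' = set0 -> h ^+ 2 <= sqdist p p'.
Proof.
move=> h0 Ap Ap' AA'; rewrite leNgt; apply/negP => pp'.
pose q : d.-tuple R := [tuple (tnth p l + tnth p' l) / 2 | l < d].
have pq : sqdist p q = sqdist p p' / 4.
  rewrite mulr_suml; apply: eq_bigr => k _; by rewrite tnth_mktuple; field.
have p'q : sqdist p' q = sqdist p p' / 4.
  rewrite mulr_suml; apply: eq_bigr => k _; by rewrite tnth_mktuple; field.
have lt4 : sqdist p p' / 4 < (h / 2) ^+ 2.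
  rewrite (_ : (h / 2) ^+ 2 = h ^+ 2 / 4); last by field.
  by rewrite ltr_pM2r// invr_gt0.
suff : set0 q by [].
by rewrite -AA'; split; [apply: Ap; rewrite pq|apply: Ap'; rewrite p'q].
Qed.

Lemma coord_le_sqdist x y k (r : R) : 0 <= r -> sqdist x y <= r ^+ 2 ->
  `|tnth y k - tnth x k| <= r.
Proof.
move=> r0 xy; rewrite -(ler_pXn2r (n := 2))// ?nnegrE// real_normK ?num_real//.
apply: le_trans xy; rewrite /sqdist (bigD1 k)//= lerDl sumr_ge0// => j _.
exact: sqr_ge0.
Qed.

End cubes.

Lemma truncn_eq_dist_lt1 (R : realType) (a b : R) : 0 <= a -> 0 <= b ->
  Num.trunc a = Num.trunc b -> `|a - b| < 1.
Proof.
move=> a0 b0 ab; have /andP[a1 a2] := truncn_itv a0.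
have /andP[b1 b2] := truncn_itv b0; rewrite -{}ab -addn1 natrD in b1 b2.
by rewrite -addn1 natrD in a2; rewrite ltr_norml; apply/andP; split; lra.
Qed.

Section packing.
Context {R : realType} {d : nat}.
Hypothesis d0 : (0 < d)%N.

Let dR : 0 < d%:R :> R. Proof. by rewrite ltr0n. Qed.

Let dR1 : 1 <= d%:R :> R. Proof. by rewrite ler1n. Qed.

Lemma sqdist_small_coords (x y : d.-tuple R) (h : R) : 0 < h ->
  (forall k, `|tnth y k - tnth x k| < h / d%:R) -> sqdist x y < h ^+ 2.
Proof.
move=> h0 xy; have step : sqdist x y < \sum_(k < d) (h / d%:R) ^+ 2.
  apply: ltr_sum => [|k _].
    by apply/hasP; exists (Ordinal d0); rewrite ?mem_index_enum.
  rewrite -[ltLHS]real_normK ?num_real//.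
  by rewrite ltr_pXn2r// nnegrE// divr_ge0// ltW.
apply: (lt_le_trans step); rewrite sumr_const card_ord -[_ *+ _]mulr_natr.
rewrite (_ : _ * _ = h ^+ 2 / d%:R); last by field; rewrite lt0r_neq0.
by rewrite ler_pdivrMr// ler_peMr// sqr_ge0.
Qed.

Lemma cube_diam (h : R) (A : set (d.-tuple R)) x y k : 0 < h -> is_cube h A ->
  A x -> A y -> `|tnth x k - tnth y k| <= d%:R * h.
Proof.
move=> h0 /(cube_between_balls h0)[p [_ Ap]].
have close z : A z -> `|tnth z k - tnth p k| <= d%:R * (h / 2).
  move=> /Ap pz; apply: coord_le_sqdist.
      by rewrite mulr_ge0 ?divr_ge0 ?(ltW h0).
  apply: le_trans pz _; rewrite [leRHS]exprMn; apply: ler_wpM2r; rewrite ?sqr_ge0//.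
  by rewrite expr2 ler_peMr.
move=> /close xp /close yp.
rewrite (_ : _ - _ = (tnth x k - tnth p k) - (tnth y k - tnth p k)); last first.
  by rewrite opprB addrA subrK.
apply: le_trans (ler_normB _ _) _; apply: le_trans (lerD xp yp) _.
by rewrite -mulrDr -splitr.
Qed.

(** The number of grid cells of mesh [h / d] in the box that contains the
centres of the cubes meeting the ball of radius [K], up to the factor
[h ^ - d]. *)
Definition packing_const (K : R) : R := (2 * (K + d%:R) * d%:R + 1) ^+ d.

Lemma packing_const_gt0 (K : R) : 0 <= K -> 0 < packing_const K.
Proof.
move=> K0; apply: exprn_gt0; have := dR.
by move: (d%:R : R) => e e0; nra.
Qed.

(** Sort the centres into the cells of an axis-parallel grid of mesh [h / d]:
by separation a grid cell receives at most one centre, so that the number of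
cubes is at most the number of grid cells in a box. This plays the role of a
comparison of volumes. *)
Lemma packing (h K : R) (A : nat -> set (d.-tuple R)) : 0 < h <= 1 -> 0 <= K ->
  (forall j, is_cube h (A j)) -> trivIset setT A ->
  exists s : seq nat, [/\ uniq s,
    forall j, j \in s <-> A j `&` [set x | euclid_norm x <= K] !=set0 &
    (size s)%:R * h ^+ d <= packing_const K].
Proof.
move=> /andP[h0 h1] K0 cubeA tA.
have /choice[p pP] : forall j, exists p, 
    (forall x, sqdist p x < (h / 2) ^+ 2 -> A j x) /\
    (forall x, A j x -> sqdist p x <= d%:R * (h / 2) ^+ 2).
  by move=> j; exact: cube_between_balls.
pose K' := K + d%:R; have K'0 : 0 <= K' by rewrite addr_ge0// ltW.
pose T := [set j | A j `&` [set x | euclid_norm x <= K] !=set0].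
have pK' j k : T j -> `|tnth (p j) k| <= K'.
  move=> [x [Ax /= xK]]; have xk : `|tnth x k| <= K.
    apply: le_trans xK; rewrite -sqrtr_sqr /euclid_norm ler_wsqrtr//.
    rewrite (bigD1 k)//= lerDl sumr_ge0// => j' _; exact: sqr_ge0.
  have : `|tnth x k - tnth (p j) k| <= d%:R.
    apply: coord_le_sqdist; first exact: ler0n.
    apply: le_trans ((pP j).2 _ Ax) _; rewrite [leRHS]expr2 ler_wpM2l ?ler0n//.
    by apply: (le_trans _ dR1); clear -h0 h1; nra.
  move=> xp; rewrite -[tnth (p j) k](subKr (tnth x k)).
  by apply: le_trans (ler_normB _ _) _; exact: lerD.
pose u j k : R := (tnth (p j) k + K') * d%:R / h.
have u0 j k : T j -> 0 <= u j k.
  move=> /(pK' _ k); rewrite ler_norml => /andP[+ _] => pj.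
  by rewrite /u divr_ge0 ?mulr_ge0 ?ler0n ?(ltW h0)// -lerBlDr sub0r.
pose Q := Num.trunc (2 * K' * d%:R / h).
have uQ j k : T j -> (Num.trunc (u j k) < Q.+1)%N.
  move=> /(pK' _ k); rewrite ler_norml => /andP[_ pj]; rewrite ltnS.
  apply: le_truncn; rewrite ler_pM2r ?invr_gt0// ler_pM2r//.
  by rewrite mulrDl mul1r lerD2r.
pose cell j : {ffun 'I_d -> 'I_Q.+1} := [ffun k => inord (Num.trunc (u j k))].
have cell_inj : {in T &, injective cell}.
  move=> i j; rewrite !inE => Ti Tj ij; apply: contrapT => nij.
  have : h ^+ 2 <= sqdist (p i) (p j).
    apply: (@cube_separation _ _ _ (A i) (A j)) => //; first exact: (pP i).1.
      exact: (pP j).1.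
    by apply: contrapT => /eqP/set0P ne; apply: nij; exact: (tA i j).
  rewrite leNgt => /negP; apply; apply: sqdist_small_coords => // k.
  have eq_u : Num.trunc (u j k) = Num.trunc (u i k).
    have /(congr1 val) := congr1 (fun f : {ffun _} => f k) ij.
    by rewrite /= !ffunE !inordK ?uQ.
  have uE : u j k - u i k = (tnth (p j) k - tnth (p i) k) * (d%:R / h).
    by rewrite /u; ring.
  have := truncn_eq_dist_lt1 (u0 _ k Tj) (u0 _ k Ti) eq_u.
  rewrite uE normrM (gtr0_norm (divr_gt0 dR h0)) -ltr_pdivlMr ?divr_gt0//.
  by rewrite div1r invf_div.
(* The list collects the unique cube attached to each occupied grid cell. *)
pose g (y : {ffun 'I_d -> 'I_Q.+1}) : option nat :=
  if pselect (exists2 j, T j & cell j = y) is left e then Some (projT1 (cid2 e))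
  else None.
exists (undup (pmap g (enum {: {ffun 'I_d -> 'I_Q.+1}}))); split.
- exact: undup_uniq.
- move=> j; rewrite mem_undup mem_pmap; split.
    move=> /mapP[y _]; rewrite /g; case: pselect => // e [->].
    by case: (cid2 e).
  move=> Tj; apply/mapP; exists (cell j); first by rewrite mem_enum.
  rewrite /g; case: pselect => [e|]; last by case; exists j.
  case: (cid2 e) => i Ti ij /=; congr Some; apply: cell_inj => //.
  - exact/mem_set.
  - exact/mem_set.
- apply: (@le_trans _ _ ((Q.+1)%:R ^+ d * h ^+ d)).
    rewrite ler_wpM2r ?exprn_ge0 ?(ltW h0)// -natrX ler_nat.
    rewrite (leq_trans (size_undup _))// size_pmap (leq_trans (count_size _ _))//.
    by rewrite -cardE card_ffun !card_ord.
  rewrite -exprMn; apply: lerXn2r; rewrite ?nnegrE.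
  + by rewrite mulr_ge0// ltW.
  + by rewrite addr_ge0// !mulr_ge0.
  have : Q%:R <= 2 * K' * d%:R / h.
    by rewrite truncn_le divr_ge0 ?mulr_ge0// ltW.
  rewrite ler_pdivlMr// => Qh.
  by rewrite -addn1 natrD mulrDl mul1r lerD.
Qed.

End packing.

(** * Transfer of integrals and products of independent variables *)

Section integral_transfer.
Local Open Scope ereal_scope.
Context {R : realType} {d' : measure_display} {T' : measurableType d'}.
Import HBNNSimple.

Section simple.
Context {d : measure_display} {T : measurableType d}.
Variables (mu : {measure set T -> \bar R}) (phi : T -> T') (g : T -> R).
Hypotheses (mphi : measurable_fun setT phi) (mg : measurable_fun setT g).
Hypothesis g0 : forall x, (0 <= g x)%R.

Lemma integral_nnsfun_comp (f : {nnsfun T' >-> R}) :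
  \int[mu]_x (f (phi x) * g x)%:E =
  \sum_(k \in range f) (k%:E * \int[mu]_x (\1_(f @^-1` [set k]) (phi x) * g x)%:E).
Proof.
have mI k : measurable_fun setT (fun x => \1_(f @^-1` [set k]) (phi x) : R).
  exact: measurableT_comp.
have mIg k : measurable_fun setT (fun x => \1_(f @^-1` [set k]) (phi x) * g x)%R.
  exact: measurable_funM.
transitivity (\sum_(k \in range f)
    \int[mu]_x (k * (\1_(f @^-1` [set k]) (phi x) * g x))%:E).
  rewrite -ge0_integral_fsum//.
  - apply: eq_integral => x _; rewrite fsumEFin// fimfunE.
    rewrite !fsbig_finite//= mulr_suml; congr EFin.
    by apply: eq_bigr => k _; rewrite mulrA.
  - by move=> k; apply/measurable_EFinP/measurable_funM.
  - by move=> k x _; rewrite mulrA EFinM mule_ge0 ?(g0, lee_fin)//;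
      rewrite -lee_fin EFinM; exact: nnfun_muleindic_ge0.
apply: eq_fsbigr => k; rewrite inE => -[y _ <-].
under eq_integral do rewrite EFinM.
rewrite ge0_integralZl//.
- exact/measurable_EFinP.
- by move=> x _; rewrite lee_fin mulr_ge0.
- by rewrite lee_fin.
Qed.

Lemma cvg_integral_nnsfun_comp (f : T' -> R) (mf : measurable_fun setT (EFin \o f)) :
  (forall y, (0 <= f y)%R) ->
  \int[mu]_x (nnsfun_approx measurableT mf n (phi x) * g x)%:E @[n --> \oo]
    --> \int[mu]_x (f (phi x) * g x)%:E.
Proof.
move=> f0; pose f_ := nnsfun_approx measurableT mf.
have -> : \int[mu]_x (f (phi x) * g x)%:E =
    \int[mu]_x limn (fun n => (f_ n (phi x) * g x)%:E).
  apply: eq_integral => x _; apply/esym/cvg_lim => //.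
  under eq_fun do rewrite EFinM; rewrite EFinM; apply: cvgeZr => //.
  by apply: cvg_nnsfun_approx => // y _; rewrite lee_fin.
apply: cvg_monotone_convergence => //.
- move=> n; apply/measurable_EFinP/measurable_funM => //.
  exact: measurableT_comp.
- by move=> n x _; rewrite lee_fin mulr_ge0.
- move=> x _ m n mn; rewrite lee_fin ler_wpM2r//.
  exact/lefP/nd_nnsfun_approx.
Qed.

End simple.

(** Equality for indicators extends to functions by monotone approximation with
simple functions. The two sides may live on different spaces and carry weights
[g1] and [g2]: this covers at once integration against a density and the
factoring out of an independent variable. *)
Lemma integral_transfer {d1 d2 : measure_display} {T1 : measurableType d1}
    {T2 : measurableType d2} (mu1 : {measure set T1 -> \bar R})
    (mu2 : {measure set T2 -> \bar R}) (phi1 : T1 -> T') (phi2 : T2 -> T')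
    (g1 : T1 -> R) (g2 : T2 -> R) :
  measurable_fun setT phi1 -> measurable_fun setT phi2 ->
  measurable_fun setT g1 -> measurable_fun setT g2 ->
  (forall x, (0 <= g1 x)%R) -> (forall x, (0 <= g2 x)%R) ->
  (forall B, measurable B -> \int[mu1]_x (\1_B (phi1 x) * g1 x)%:E =
                             \int[mu2]_x (\1_B (phi2 x) * g2 x)%:E) ->
  forall f : T' -> R, measurable_fun setT f -> (forall y, (0 <= f y)%R) ->
  \int[mu1]_x (f (phi1 x) * g1 x)%:E = \int[mu2]_x (f (phi2 x) * g2 x)%:E.
Proof.
move=> mphi1 mphi2 mg1 mg2 g10 g20 eqI f mf f0.
have mf' : measurable_fun setT (EFin \o f) by exact/measurable_EFinP.
have c1 := cvg_integral_nnsfun_comp (mu := mu1) mphi1 mg1 g10 mf' f0.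
have c2 := cvg_integral_nnsfun_comp (mu := mu2) mphi2 mg2 g20 mf' f0.
apply: (cvg_unique _ c1) => //; rewrite (_ : (fun _ => _) = fun n =>
  \int[mu2]_x (nnsfun_approx measurableT mf' n (phi2 x) * g2 x)%:E)//.
apply/funext => n; rewrite !integral_nnsfun_comp//.
by apply: eq_fsbigr => k _; rewrite eqI.
Qed.

End integral_transfer.

Section product_of_independent.
Local Open Scope ereal_scope.
Context {R : realType} {d d' : measure_display} {T : measurableType d}.
Context {T' : measurableType d'} (P : probability T R) {n : nat}.
Variable V : 'I_n -> T -> T'.
Hypothesis mV : forall i, measurable_fun setT (V i).
Hypothesis indepV : forall B : 'I_n -> set T', (forall i, measurable (B i)) ->
  P (\bigcap_i V i @^-1` B i) = (\prod_i fine (P (V i @^-1` B i)))%:E.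

Let mVB i B : measurable B -> measurable (V i @^-1` B).
Proof. by move=> mB; rewrite -[X in measurable X]setTI; exact: mV. Qed.

Let integral_indic_comp i B : measurable B ->
  \int[P]_x (\1_B (V i x))%:E = P (V i @^-1` B).
Proof. by move=> mB; rewrite -[X in P X]setIT -integral_indic//; exact: mVB. Qed.

(** The product rule passes from sets to functions one factor at a time: with
the other factors fixed, both sides are integrals in the factor [f i] and agree
when it is an indicator. *)
Lemma integral_prod_independent (f : 'I_n -> T' -> R) (e : 'I_n -> R) :
  (forall i, measurable_fun setT (f i)) -> (forall i y, (0 <= f i y)%R) ->
  (forall i, \int[P]_x (f i (V i x))%:E = (e i)%:E) ->
  \int[P]_x (\prod_i f i (V i x))%:E = (\prod_i e i)%:E.
Proof.
suff main k : (k <= n)%N -> forall (f : 'I_n -> T' -> R) (e : 'I_n -> R),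
    (forall i : 'I_n, (k <= i)%N -> exists2 B, measurable B & f i = \1_B) ->
    (forall i, measurable_fun setT (f i)) -> (forall i y, (0 <= f i y)%R) ->
    (forall i, \int[P]_x (f i (V i x))%:E = (e i)%:E) ->
    \int[P]_x (\prod_i f i (V i x))%:E = (\prod_i e i)%:E.
  by apply: (main n) => // i; rewrite leqNgt ltn_ord.
(* Induction on the number [k] of factors that are not indicators. *)
elim: k => [_|k IH kn] {}f {}e find mf f0 ef.
  have {find}/choice[B BP] i : exists B, measurable B /\ f i = \1_B.
    by have [//|B] := find i; exists B.
  transitivity (\int[P]_x (\1_(\bigcap_i V i @^-1` B i) x)%:E).
    apply: eq_integral => x _; congr EFin.
    rewrite indicE; have [/set_mem Vx|Vx] := boolP (x \in _).
      by rewrite big1// => i _; rewrite (BP i).2 indicE mem_set//; exact: Vx.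
    have [i nVi] : exists i, ~ B i (V i x).
      apply: contrapT => nV; move/negP: Vx; apply; apply/mem_set => i _ /=.
      by apply: contrapT => nVi; apply: nV; exists i.
    by rewrite (bigD1 i)//= (BP i).2 indicE memNset// mul0r.
  have mB i : measurable (B i) by case: (BP i).
  rewrite integral_indic//; last first.
    by apply: fin_bigcap_measurable => // i _; exact: mVB.
  rewrite setIT; apply: (etrans (indepV mB)); congr EFin; apply: eq_bigr => i _.
  by rewrite -[RHS]/(fine (e i)%:E) -ef (BP i).2 integral_indic_comp.
pose j := Ordinal kn; pose g x : R := (\prod_(i | i != j) f i (V i x))%R.
pose c : R := (\prod_(i | i != j) e i)%R.
have e0 i : (0 <= e i)%R.
  by rewrite -lee_fin -ef; apply: integral_ge0 => x _; rewrite lee_fin.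
have c0 : (0 <= c)%R by apply: prodr_ge0.
have mg : measurable_fun setT g.
  rewrite (_ : g = fun x => \prod_i (if i != j then f i (V i x) else 1))%R.
    by apply: measurable_prod => i _; case: (i != j) => //; exact: measurableT_comp.
  by apply/funext => x; rewrite /g big_mkcond.
have key B : measurable B -> \int[P]_x (\1_B (V j x) * g x)%:E =
    \int[P]_x (\1_B (V j x) * cst c x)%:E.
  move=> mB; pose f' i := if i == j then \1_B : T' -> R else f i.
  pose e' i := if i == j then fine (P (V j @^-1` B)) else e i.
  transitivity (\int[P]_x (\prod_i f' i (V i x))%:E).
    apply: eq_integral => x _; rewrite (bigD1 j)//= /f' eqxx; congr (_ * _)%:E.
    by apply: eq_bigr => i /negbTE ->.
  transitivity (\prod_i e' i)%:E; last first.
    rewrite (bigD1 j)//= /e' eqxx; under eq_bigr => i /negbTE -> do over.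
    under eq_integral do rewrite EFinM.
    rewrite ge0_integralZr//; last first.
      by apply/measurable_EFinP; exact: measurableT_comp.
    by rewrite integral_indic_comp// EFinM fineK// fin_num_measure//; exact: mVB.
  apply: IH; first exact: ltnW.
  - move=> i ki; rewrite /f'; case: eqP => [_|/eqP ij]; first by exists B.
    apply: find; rewrite ltn_neqAle ki andbT.
    by apply: contra ij => /eqP ki'; apply/eqP/val_inj.
  - by move=> i; rewrite /f'; case: (i == j).
  - by move=> i y; rewrite /f'; case: (i == j).
  - move=> i; rewrite /f' /e'; case: eqP => [->|_]; last exact: ef.
    rewrite integral_indic_comp// fineK//; apply: fin_num_measure; exact: mVB.
have g0 x : (0 <= g x)%R by apply: prodr_ge0.
have tr := integral_transfer (mu1 := P) (mu2 := P) (mV j) (mV j) mg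
  (measurable_cst c) g0 (fun=> c0) key (mf j) (f0 j).
transitivity (\int[P]_x (f j (V j x) * g x)%:E).
  by apply: eq_integral => x _; rewrite (bigD1 j).
rewrite tr (bigD1 j)//= EFinM -ef -ge0_integralZr//.
- by apply/measurable_EFinP; exact: measurableT_comp.
- by move=> x _; rewrite lee_fin.
Qed.

End product_of_independent.

(** * Exponential moments and deviations of averages *)

Section exponential_moments.
Context {R : realType}.

Lemma expR_le_quadratic (x : R) : `|x| <= 1 / 2 -> expR x <= 1 + x + 2 * x ^+ 2.
Proof.
rewrite ler_norml => /andP[x1 x2].
have x3 : 0 < 1 - x by lra.
have e : (1 - x) * expR x <= 1.
  by rewrite -ler_pdivlMr ?expR_gt0// div1r -expRN expR_ge1Dx.
rewrite -(ler_pM2l x3) (le_trans e)//.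
by nra.
Qed.

Lemma geometric_le_expR (u : R) : 0 <= u <= 1 -> (1 - u / 2)^-1 <= expR u.
Proof.
move=> /andP[u0 u1]; apply: le_trans (expR_ge1Dx u).
have u2 : 0 < 1 - u / 2 by lra.
rewrite -[leLHS]div1r ler_pdivrMr//; nra.
Qed.

Local Open Scope ereal_scope.
Notation mu := (@lebesgue_measure R).

Lemma ge0_integral_reflect (f : R -> R) : measurable_fun setT f ->
  (forall x, (0 <= f x)%R) ->
  \int[mu]_x (f (- x))%:E = \int[mu]_x (f x)%:E.
Proof.
move=> mf f0; transitivity (\int[mu]_(x in (-%R : _ -> measurableTypeR R) @^-1` setT)
    ((EFin \o f) \o -%R) x); first by [].
rewrite -ge0_integral_pushforward//=.
- by apply: eq_measure_integral => //= A mA _; exact: lebesgue_measureN.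
- exact/measurable_EFinP.
- by move=> y _; rewrite lee_fin.
Qed.

Lemma laplace_pdf_ge0 (x : R) : (0 <= laplace_pdf x)%R.
Proof. by rewrite /laplace_pdf divr_ge0// expR_ge0. Qed.

Lemma measurable_laplace_pdf : measurable_fun setT (@laplace_pdf R).
Proof.
apply: measurable_funM => //; apply: measurableT_comp => //.
by apply: measurable_funN; apply: measurable_funM => //; exact: measurableT_comp.
Qed.

(** The tilted Laplace density is carried by two exponential densities, one on
each half-line; the bound is strict only at the origin, where both count. *)
Lemma laplace_tilt_le (l x : R) : (0 < Num.sqrt 2 - l)%R -> (0 < Num.sqrt 2 + l)%R ->
  (expR (l * x) * laplace_pdf x <= (Num.sqrt 2)^-1 *
    ((Num.sqrt 2 - l)^-1 * exponential_pdf (Num.sqrt 2 - l) x +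
     (Num.sqrt 2 + l)^-1 * exponential_pdf (Num.sqrt 2 + l) (- x)))%R.
Proof.
move=> a0 b0; rewrite /laplace_pdf mulrA -expRD mulrC ler_wpM2l ?invr_ge0//.
have [x0|x0] := leP 0%R x.
  rewrite (exponential_pdfE _ x0) mulrA mulVf ?gt_eqF// mul1r.
  rewrite ger0_norm// (_ : _ - _ = - (Num.sqrt 2 - l) * x)%R; last by ring.
  by rewrite lerDl mulr_ge0 ?invr_ge0 ?exponential_pdf_ge0// ltW.
have x0' : (0 <= - x)%R by rewrite oppr_ge0 ltW.
rewrite (exponential_pdfE _ x0') mulrA mulVf ?gt_eqF// mul1r.
rewrite ltr0_norm// (_ : _ - _ = - (Num.sqrt 2 + l) * - x)%R; last by ring.
by rewrite lerDr mulr_ge0 ?invr_ge0 ?exponential_pdf_ge0// ltW.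
Qed.

Lemma laplace_mgf_le (l : R) : (`|l| <= 1)%R ->
  \int[mu]_x (expR (l * x) * laplace_pdf x)%:E <= (expR (l ^+ 2))%:E.
Proof.
rewrite ler_norml => /andP[l1 l2]; set s := Num.sqrt (2 : R).
have s2 : (s ^+ 2 = 2)%R by rewrite sqr_sqrtr.
have s0 : (0 < s)%R by rewrite sqrtr_gt0.
have a0 : (0 < s - l)%R by nra.
have b0 : (0 < s + l)%R by nra.
have mpdf r : measurable_fun setT (@exponential_pdf R r).
  exact: measurable_exponential_pdf.
have mpdfN r : measurable_fun setT (fun x : R => @exponential_pdf R r (- x)%R).
  exact: measurableT_comp.
have pdf0 (r x : R) : (0 < r -> 0 <= exponential_pdf r x)%R.
  by move=> r0; apply: exponential_pdf_ge0; exact: ltW.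
pose f1 x : R := ((s - l)^-1 * exponential_pdf (s - l) x)%R.
pose f2 x : R := ((s + l)^-1 * exponential_pdf (s + l) (- x))%R.
have f10 x : (0 <= f1 x)%R by rewrite mulr_ge0 ?pdf0 ?invr_ge0// ltW.
have f20 x : (0 <= f2 x)%R by rewrite mulr_ge0 ?pdf0 ?invr_ge0// ltW.
have mf1 : measurable_fun setT f1 by exact: measurable_funM.
have mf2 : measurable_fun setT f2 by exact: measurable_funM.
apply: (@le_trans _ _ (\int[mu]_x (s^-1%:E * ((f1 x)%:E + (f2 x)%:E)))).
  apply: ge0_le_integral => //=.
  - move=> x _; rewrite lee_fin mulr_ge0 ?expR_ge0//.
    exact: laplace_pdf_ge0.
  - apply/measurable_EFinP; apply: measurable_funM; last first.
      exact: measurable_laplace_pdf.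
    by apply: measurableT_comp => //; exact: measurable_funM.
  - by apply/measurable_EFinP; apply: measurable_funM => //; exact: measurable_funD.
  - by move=> x _; rewrite lee_fin; exact: laplace_tilt_le.
rewrite ge0_integralZl//; last 3 first.
- by apply/measurable_EFinP; exact: measurable_funD.
- by move=> x _; rewrite -EFinD lee_fin addr_ge0.
- by rewrite lee_fin invr_ge0 ltW.
rewrite ge0_integralD//; last 4 first.
- by move=> x _; rewrite lee_fin.
- exact/measurable_EFinP.
- by move=> x _; rewrite lee_fin.
- exact/measurable_EFinP.
have scaled (r : R) (f : R -> R) : (0 < r)%R -> measurable_fun setT f ->
    (forall x, (0 <= f x)%R) -> \int[mu]_x (f x)%:E = 1 ->
    \int[mu]_x (r^-1 * f x)%:E = r^-1%:E.
  move=> r0 mf f0 f1E; under eq_integral do rewrite EFinM.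
  rewrite ge0_integralZl//; last 3 first.
  - exact/measurable_EFinP.
  - by move=> x _; rewrite lee_fin.
  - by rewrite lee_fin invr_ge0 ltW.
  by rewrite f1E mule1.
rewrite scaled// ?integral_exponential_pdf//; last by move=> x; exact: pdf0.
rewrite scaled//; last 2 first.
- by move=> x; exact: pdf0.
- rewrite (ge0_integral_reflect (mpdf _)) ?integral_exponential_pdf// => x.
  exact: pdf0.
rewrite -EFinD -EFinM lee_fin.
rewrite (_ : (_ * _)%R = (1 - l ^+ 2 / 2)^-1)%R.
  by apply: geometric_le_expR; apply/andP; split; nra.
have e : (2 - l ^+ 2 = (s - l) * (s + l))%R by rewrite -s2; ring.
rewrite (_ : 1 - l ^+ 2 / 2 = (s - l) * (s + l) / 2)%R; last by rewrite -e; field.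
by field; rewrite !gt_eqF.
Qed.

End exponential_moments.

Section deviations.
Local Open Scope ereal_scope.
Context {R : realType} {d : measure_display} {T : measurableType d}.
Variable P : probability T R.

(** The range of [l] is restricted because the Laplace law has exponential
moments only near the origin. *)
Definition locally_subgaussian (V : T -> R) (m c l0 : R) :=
  forall l, (`|l| <= l0)%R ->
    \int[P]_x (expR (l * V x))%:E <= (expR (l * m + c * l ^+ 2))%:E.

Lemma laplace_subgaussian (V : {RV P >-> R}) (s : R) : (0 < s)%R ->
  (forall B : set R, measurable B -> distribution P V B = laplace_prob B) ->
  locally_subgaussian (fun x => s * V x)%R 0 (s ^+ 2) s^-1.
Proof.
move=> s0 lawV l ls; have ls1 : (`|l * s| <= 1)%R.
  by rewrite normrM (gtr0_norm s0) -ler_pdivlMr// div1r.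
rewrite mulr0 add0r -exprMn [(s * l)%R]mulrC.
apply: le_trans (laplace_mgf_le ls1).
rewrite le_eqVlt; apply/orP; left; apply/eqP.
transitivity (\int[P]_x (expR (l * s * V x) * cst 1%R x)%:E).
  by apply: eq_integral => x _; rewrite mulr1 mulrA.
have tr := @integral_transfer R _ (measurableTypeR R) _ _ T (measurableTypeR R) P
  lebesgue_measure V idfun (cst 1%R) laplace_pdf.
apply: (tr _ _ _ _ _ _ _ (fun y => expR (l * s * y))) => //.
- exact: (measurable_funP V).
- exact: measurable_id.
- exact: measurable_laplace_pdf.
- exact: laplace_pdf_ge0.
- move=> B mB; transitivity (distribution P V B).
    rewrite /distribution /pushforward -[X in P X]setIT -integral_indic//.
      by apply: eq_integral => x _; rewrite mulr1.
    exact: measurable_funPTI.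
  rewrite lawV// [LHS]integral_mkcond; apply: eq_integral => x _.
  rewrite patchE indicE/=; case: ifPn => xB; first by rewrite mul1r.
  by rewrite mul0r.
- by apply: measurableT_comp => //; exact: measurable_funM.
Qed.

(** With [p] and [q] the masses of the values [1] and [-1], the moment generating
function is [1 + p (exp l - 1) + q (exp (- l) - 1)], and a quadratic bound of the
exponential leaves [1 + l (p - q) + 2 l ^ 2] at most. *)
Lemma signed_indic_subgaussian (B1 B2 : set T) : measurable B1 -> measurable B2 ->
  B1 `&` B2 = set0 ->
  locally_subgaussian (fun x => \1_B1 x - \1_B2 x)%R
    (fine (P B1) - fine (P B2)) 2 (1 / 2).
Proof.
move=> mB1 mB2 B12 l l2.
set p := fine (P B1); set q := fine (P B2).
have P1 : P B1 = p%:E by rewrite fineK// fin_num_measure.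
have P2 : P B2 = q%:E by rewrite fineK// fin_num_measure.
have p0 : (0 <= p)%R by exact: fine_ge0.
have q0 : (0 <= q)%R by exact: fine_ge0.
have PU : P (B1 `|` B2) = (p + q)%:E.
  by rewrite EFinD -P1 -P2; exact: measureU.
have pq : (p + q <= 1)%R.
  by rewrite -lee_fin -PU; apply: probability_le1; exact: measurableU.
have P3 : P (~` (B1 `|` B2)) = (1 - (p + q))%:E.
  transitivity (1 - P (B1 `|` B2)).
    by apply: probability_setC; exact: measurableU.
  by rewrite PU.
(* The exponential is a simple function. *)
pose f x : R := (\1_(~` (B1 `|` B2)) x + expR l * \1_B1 x + expR (- l) * \1_B2 x)%R.
have fE x : expR (l * (\1_B1 x - \1_B2 x)) = f x.
  rewrite /f !indicE; have [/set_mem x1|x1] := boolP (x \in B1).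
    have [/set_mem x2|x2] := boolP (x \in B2); first by have : set0 x by rewrite -B12.
    rewrite memNset; last by move=> /(_ (or_introl x1)).
    by rewrite subr0 !mulr1 mulr0 add0r addr0.
  have [/set_mem x2|x2] := boolP (x \in B2).
    rewrite memNset; last by move=> /(_ (or_intror x2)).
    by rewrite sub0r mulrN !mulr1 mulr0 !add0r.
  rewrite mem_set; first by rewrite subrr mulr0 expR0 !mulr0 !addr0.
  by move: x1 x2 => /negP x1 /negP x2 [] /mem_set.
have mC : measurable (~` (B1 `|` B2)) by apply: measurableC; exact: measurableU.
have int_ind (k : R) B : measurable B -> (0 <= k)%R ->
    \int[P]_x (k * \1_B x)%:E = k%:E * P B.
  move=> mB k0; under eq_integral do rewrite EFinM.
  rewrite ge0_integralZl//; last exact/measurable_EFinP/measurable_indic.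
  by rewrite integral_indic// setIT.
have mi (k : R) B : measurable B -> measurable_fun setT (fun x : T => k * \1_B x)%R.
  by move=> mB; apply: measurable_funM => //; exact: measurable_indic.
have mf1 := mi _ _ mB1 : measurable_fun setT (fun x : T => expR l * \1_B1 x)%R.
have mf2 := mi _ _ mB2 : measurable_fun setT (fun x : T => expR (- l) * \1_B2 x)%R.
have -> : \int[P]_x (expR (l * (\1_B1 x - \1_B2 x)))%:E =
    (1 - (p + q) + expR l * p + expR (- l) * q)%:E.
  under eq_integral do rewrite fE /f 2!EFinD.
  rewrite ge0_integralD//; last 3 first.
  - by move=> x _; rewrite -EFinD lee_fin addr_ge0// ?mulr_ge0 ?expR_ge0.
  - by apply/measurable_EFinP; exact: measurable_funD.
  - exact/measurable_EFinP.
  rewrite ge0_integralD//; last 2 first.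
  - by apply/measurable_EFinP; exact: measurable_indic.
  - exact/measurable_EFinP.
  have -> : \int[P]_x (\1_(~` (B1 `|` B2)) x)%:E = (1 - (p + q))%:E.
    by rewrite integral_indic// setIT; exact: P3.
  by rewrite !int_ind ?expR_ge0// P1 P2.
rewrite lee_fin (le_trans _ (expR_ge1Dx _))//.
have e1 := expR_le_quadratic l2.
have e2 : (expR (- l) <= 1 + - l + 2 * (- l) ^+ 2)%R.
  by apply: expR_le_quadratic; rewrite normrN.
rewrite sqrrN in e2.
have := ler_wpM2r p0 e1; have := ler_wpM2r q0 e2.
have := ler_wpM2l (sqr_ge0 l) pq.
move: (expR l) (expR (- l)) => a b; nra.
Qed.

Section average.
Context {n : nat}.
Variable V : 'I_n -> T -> R.
Hypothesis mV : forall i, measurable_fun setT (V i).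
Hypothesis indepV : forall B : 'I_n -> set R, (forall i, measurable (B i)) ->
  P (\bigcap_i V i @^-1` B i) = (\prod_i fine (P (V i @^-1` B i)))%:E.
Variables (m c l0 : R).
Hypothesis subV : forall i, locally_subgaussian (V i) m c l0.

Lemma measurable_sum_ge (l a : R) : measurable [set x | a <= l * \sum_(i < n) V i x]%R.
Proof.
rewrite -[X in measurable X]setTI.
apply: (@measurable_fun_le _ T R setT (cst a) (fun x => l * \sum_(i < n) V i x)%R) => //.
apply: measurable_funM => //.
exact: measurable_sum.
Qed.

Lemma sum_tail (l a : R) : (`|l| <= l0)%R ->
  P [set x | a <= l * \sum_(i < n) V i x]%R <=
  (expR (n%:R * (l * m + c * l ^+ 2) - a))%:E.
Proof.
move=> ll0; set E := [set x | _].
have mE : measurable E by exact: measurable_sum_ge.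
have mexp i : measurable_fun setT (fun x => expR (l * V i x)).
  by apply: measurableT_comp => //; exact: measurable_funM.
pose e i := fine (\int[P]_x (expR (l * V i x))%:E).
have int_ge0 i : 0 <= \int[P]_x (expR (l * V i x))%:E.
  by apply: integral_ge0 => x _; rewrite lee_fin expR_ge0.
have eE i : \int[P]_x (expR (l * V i x))%:E = (e i)%:E.
  rewrite fineK// ge0_fin_numE//.
  by apply: le_lt_trans (subV i ll0) _; exact: ltry.
have e0 i : (0 <= e i)%R by rewrite -lee_fin -eE.
have e_le i : (e i <= expR (l * m + c * l ^+ 2))%R.
  by rewrite -lee_fin -eE; exact: subV.
have prodE : \int[P]_x (\prod_i expR (l * V i x))%:E = (\prod_i e i)%:E.
  apply: (integral_prod_independent mV indepV (f := fun i y => expR (l * y))) => //.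
  by move=> i; apply: measurableT_comp => //; exact: measurable_funM.
have markov : (expR a)%:E * P E <= (\prod_i e i)%:E.
  have -> : P E = \int[P]_x (\1_E x)%:E by rewrite integral_indic// setIT.
  rewrite -prodE -ge0_integralZl//; last first.
    by apply/measurable_EFinP; exact: measurable_indic.
  apply: ge0_le_integral => //.
  - apply: measurable_funeM; apply/measurable_EFinP; exact: measurable_indic.
  - by apply/measurable_EFinP; exact: measurable_prod.
  - move=> x _; rewrite -EFinM lee_fin -expR_sum -mulr_sumr indicE.
    have [/set_mem Ex|_] := boolP (x \in E); last by rewrite mulr0 expR_ge0.
    by rewrite mulr1 ler_expR.
rewrite expRD expRN EFinM lee_pdivlMr ?expR_gt0// muleC (le_trans markov)//.
rewrite lee_fin mulrC expRM_natr.
rewrite -[X in (_ ^+ X)%R]card_ord -prodr_const; apply: ler_prod => i _.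
by rewrite e0 e_le.
Qed.

(** Chernoff's bound with the optimal tilt [t / (2 c)]; the upper bound on [t]
keeps this tilt in the range where the moments are controlled. *)
Lemma mean_deviation (t : R) : (0 < n)%N -> (0 < c)%R -> (0 < t <= 2 * c * l0)%R ->
  P [set x | t <= `|n%:R^-1 * (\sum_(i < n) V i x) - m|]%R <=
  (2 * expR (- (n%:R * t ^+ 2 / (4 * c))))%:E.
Proof.
move=> n0 c0 /andP[t0 tl]; pose l := (t / (2 * c))%R.
have nR : (0 < n%:R :> R)%R by rewrite ltr0n.
have l_gt0 : (0 < l)%R by rewrite divr_gt0// mulr_gt0.
have l_le : (`|l| <= l0)%R.
  by rewrite gtr0_norm// ler_pdivrMr ?mulr_gt0// mulrC.
set E := [set x | _].
pose E1 := [set x | l * (n%:R * (m + t)) <= l * \sum_(i < n) V i x]%R.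
pose E2 := [set x | - l * (n%:R * (m - t)) <= - l * \sum_(i < n) V i x]%R.
have mE1 : measurable E1 by exact: measurable_sum_ge.
have mE2 : measurable E2 by exact: measurable_sum_ge.
have EE : E `<=` E1 `|` E2.
  move=> x; rewrite /E /E1 /E2/= !mulNr lerN2 !ler_pM2l//.
  set u := (n%:R^-1 * _)%R.
  have -> : (\sum_(i < n) V i x = n%:R * u)%R by rewrite mulVKf// gt_eqF.
  rewrite !ler_pM2l//; have [um|um] := leP 0%R (u - m)%R.
    by rewrite ger0_norm// => tum; left; lra.
  by rewrite ltr0_norm// => tum; right; lra.
have lt4 : (l * t - c * l ^+ 2 = t ^+ 2 / (4 * c))%R.
  by rewrite /l; field; rewrite gt_eqF.
apply: le_trans (le_trans (le_measure P _ _ EE) (measureU2 _ mE1 mE2)) _.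
- rewrite inE -[X in measurable X]setTI.
  apply: (@measurable_fun_le _ T R setT (cst t)
    (fun x => `|n%:R^-1 * (\sum_(i < n) V i x) - m|)%R) => //.
  apply: measurableT_comp => //; apply: measurable_funB => //.
  by apply: measurable_funM => //; exact: measurable_sum.
- by rewrite inE; exact: measurableU.
have b1 : P E1 <= (expR (- (n%:R * t ^+ 2 / (4 * c))))%:E.
  apply: le_trans (sum_tail _ l_le) _; rewrite lee_fin ler_expR.
  by rewrite -mulrA -lt4 le_eqVlt; apply/orP; left; apply/eqP; ring.
have b2 : P E2 <= (expR (- (n%:R * t ^+ 2 / (4 * c))))%:E.
  apply: le_trans (sum_tail _ _) _; first by rewrite normrN.
  rewrite lee_fin ler_expR.
  by rewrite -mulrA -lt4 le_eqVlt; apply/orP; left; apply/eqP; ring.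
by rewrite mulr_natl mulr2n EFinD; exact: leeD.
Qed.

End average.
End deviations.

(** * Almost sure eventual avoidance *)

Section borel_cantelli.
Local Open Scope ereal_scope.
Context {R : realType} {d : measure_display} {T : measurableType d}.
Variable P : probability T R.

Lemma inv_sqr_le_telescope (n k : nat) : (n.+2 <= k)%N ->
  ((k%:R ^+ 2)^-1 <= n.+1%:R^-1 - n.+2%:R^-1 :> R)%R.
Proof.
move=> nk; apply: (@le_trans _ _ (n.+2%:R ^+ 2)^-1)%R.
  by rewrite lef_pV2 ?posrE ?exprn_gt0 ?ltr0n ?(leq_trans _ nk)//
    lerXn2r// ?nnegrE// ler_nat.
rewrite -addn1 natrD -(addn1 n) natrD.
have : (0 <= n%:R :> R)%R by [].
move: (n%:R : R) => x x0.
rewrite -subr_ge0 (_ : _ - _ = ((x + 1) * (x + 1 + 1) ^+ 2)^-1)%R.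
  by rewrite invr_ge0 mulr_ge0 ?sqr_ge0// addr_ge0.
by field; rewrite !gt_eqF//=; lra.
Qed.

(** Borel-Cantelli, where the bound [C / n ^ 2] is summed by telescoping. *)
Lemma ae_eventually_not (F : nat -> set T) (C : R) :
  (forall n, measurable (F n)) -> (0 <= C)%R ->
  (\forall n \near \oo, P (F n) <= (C / n%:R ^+ 2)%:E) ->
  {ae P, forall x, \forall n \near \oo, ~ F n x}.
Proof.
move=> mF C0 [N _ PF]; pose F' n := F (n + N.+2)%N.
have sumF' n : \sum_(0 <= k < n) P (F' k) <= (C * (1 - n.+1%:R^-1))%:E.
  elim: n => [|n IH]; first by rewrite big_geq// invr1 subrr mulr0.
  rewrite big_nat_recr//=; apply: le_trans (leeD IH (PF _ _)) _.
    by rewrite /= !addnS ltnW// ltnW// ltnS ltnS leq_addl.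
  rewrite -EFinD lee_fin -mulrDr ler_wpM2l//.
  have := @inv_sqr_le_telescope n (n + N.+2).
  rewrite !addnS !ltnS leq_addr => /(_ isT).
  move: (_ ^- 2)%R (n.+1%:R^-1)%R (n.+2%:R^-1)%R => x y z; clear => xyz.
  by rewrite -addrA lerD2l; lra.
have : P (lim_sup_set F') = 0.
  apply: lim_sup_set_cvg0 => //; first by move=> n; exact: mF.
  apply: (@le_lt_trans _ _ C%:E); last exact: ltry.
  apply: lime_le; first exact: is_cvg_nneseries.
  apply: nearW => n; apply: le_trans (sumF' n) _.
  by rewrite lee_fin -[leRHS]mulr1 ler_wpM2l// gerBl invr_ge0.
move=> limF'; exists (lim_sup_set F'); split => //.
  apply: bigcapT_measurable => n; apply: bigcup_measurable => k _; exact: mF.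
move=> x /= nx n _; apply: contrapT => nFx; apply: nx.
exists (n + N.+2)%N => // k /= nk Fk; apply: nFx.
have Nk : (N.+2 <= k)%N by apply: leq_trans nk; exact: leq_addl.
exists (k - N.+2)%N; first by rewrite /= leq_subRL// addnC.
by rewrite /F' subnK.
Qed.

End borel_cantelli.

(** As soon as [h n <= 1] and [n h ^ (2 d) >= 1], the number [h ^ - d] of cells
is at most [h ^ - (2 d) <= n]; and the exponential is at most [n ^ - 3] once
[n h ^ (2 d) >= (3 / a) ln n]. *)
Lemma near_rate (R : realType) (d : nat) (h : nat -> R) : (forall n, 0 < h n) ->
  h n @[n --> \oo] --> (0 : R) ->
  n%:R * h n ^+ (2 * d) / ln n%:R @[n --> \oo] --> +oo ->
  forall a : R, 0 < a -> \forall n \near \oo, [/\ (0 < n)%N, h n <= 1 &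
    (h n ^+ d)^-1 * expR (- (a * (n%:R * h n ^+ (2 * d)))) <= (n%:R ^+ 2)^-1].
Proof.
move=> h0 hcv rate a a0; near=> n.
have n1 : expR 1 <= n%:R :> R by near: n; exact: nbhs_infty_ger.
have nR : 0 < n%:R :> R by apply: lt_le_trans n1; exact: expR_gt0.
have n0 : (0 < n)%N by rewrite -(ltr0n R).
have ln1 : 1 <= ln n%:R :> R by rewrite -[leLHS]expRK ler_ln ?posrE ?expR_gt0.
have ln0 : 0 < ln n%:R :> R by apply: lt_le_trans ln1.
have h1 : h n <= 1.
  by apply: ltW; near: n; move/cvgr_lt : hcv; apply; exact: ltr01.
have rb b : b <= n%:R * h n ^+ (2 * d) / ln n%:R -> b * ln n%:R <= n%:R * h n ^+ (2 * d).
  by rewrite ler_pdivlMr.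
have r1 : 1 <= n%:R * h n ^+ (2 * d).
  apply: le_trans ln1 _; rewrite -[leLHS]mul1r; apply: rb.
  by near: n; move/cvgryPge : rate; exact.
have ra : 3 / a * ln n%:R <= n%:R * h n ^+ (2 * d).
  by apply: rb; near: n; move/cvgryPge : rate; exact.
split => //.
have hd : (h n ^+ d)^-1 <= n%:R.
  rewrite invf_ple ?posrE ?exprn_gt0//.
  rewrite -[leLHS]mul1r ler_pdivrMr// (le_trans r1)// mulrC ler_wpM2r//.
  by rewrite ler_wiXn2l ?(ltW (h0 n))// leq_pmull.
have ex : expR (- (a * (n%:R * h n ^+ (2 * d)))) <= (n%:R ^+ 3)^-1.
  rewrite expRN lef_pV2 ?posrE ?expR_gt0 ?exprn_gt0//.
  rewrite -[X in X ^+ 3 <= _]lnK ?posrE// -expRM_natl ler_expR.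
  by rewrite -ler_pdivrMl// mulrA (mulrC _ 3) .
apply: le_trans (ler_pM _ _ hd ex) _.
- by rewrite invr_ge0 exprn_ge0// ltW.
- exact: expR_ge0.
- by rewrite exprS invfM mulrA divff ?mul1r// gt_eqF.
Unshelve. all: by end_near. Qed.

(** * Approximation of Borel sets by uniformly continuous functions *)

Lemma max_dist {R : realDomainType} (a b u v : R) :
  `|Num.max a b - Num.max u v| <= `|a - u| + `|b - v|.
Proof.
rewrite ler_norml; have := ler_norm (a - u); have := ler_norm (b - v).
have := ler_norm (u - a); have := ler_norm (v - b).
rewrite (distrC v) (distrC u) => h1 h2 h3 h4.
have := normr_ge0 (a - u); have := normr_ge0 (b - v).
move: (`|a - u|) (`|b - v|) h1 h2 h3 h4 => p q.
by have [ab|ab] := leP a b; have [uv|uv] := leP u v; move=> *;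
  apply/andP; split; lra.
Qed.

Section borel_approximation.
Local Open Scope ereal_scope.
Context {R : realType} {d : nat}.
Variable Q : probability (d.-tuple R) R.
Implicit Types (f g : d.-tuple R -> R) (B : set (d.-tuple R)).

Definition coord_ucont f := forall e : R, (0 < e)%R -> exists2 del : R, (0 < del)%R &
  forall x y, (forall k, `|tnth x k - tnth y k| <= del)%R -> (`|f x - f y| <= e)%R.

Definition smooth_indicator f :=
  [/\ measurable_fun setT f, forall x, (0 <= f x <= 1)%R & coord_ucont f].

Definition approximable B := measurable B /\ forall e : R, (0 < e)%R ->
  exists2 f, smooth_indicator f & \int[Q]_x (`|f x - \1_B x|)%:E <= e%:E.

Let mdist f g : measurable_fun setT f -> measurable_fun setT g ->
  measurable_fun setT (fun x => (`|f x - g x|)%:E).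
Proof.
move=> mf mg; apply/measurable_EFinP; apply: measurableT_comp => //.
exact: measurable_funB.
Qed.

Let le_dist f g (u v : d.-tuple R -> R) : measurable_fun setT f -> measurable_fun setT g ->
  measurable_fun setT u -> measurable_fun setT v ->
  forall (f' g' : d.-tuple R -> R), measurable_fun setT f' -> measurable_fun setT g' ->
  (forall x, `|f' x - g' x| <= `|f x - g x| + `|u x - v x|)%R ->
  \int[Q]_x (`|f' x - g' x|)%:E <=
  \int[Q]_x (`|f x - g x|)%:E + \int[Q]_x (`|u x - v x|)%:E.
Proof.
move=> mf mg mu mv f' g' mf' mg' le.
rewrite -ge0_integralD//; [|exact: mdist|exact: mdist].
apply: ge0_le_integral => //; first exact: mdist.
- by apply: emeasurable_funD; exact: mdist.
- by move=> x _; rewrite -EFinD lee_fin.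
Qed.

Lemma approximable0 : approximable set0.
Proof.
split => // e e0; exists (cst 0%R).
  split => //; first by move=> x; rewrite lexx ler01.
  by move=> del del0; exists 1%R => // x y _; rewrite subrr normr0 ltW.
rewrite integral0_eq ?lee_fin ?ltW// => x _.
by rewrite indicE in_set0/= subrr normr0.
Qed.

Lemma approximableC B : approximable B -> approximable (~` B).
Proof.
move=> [mB aB]; split; first exact: measurableC.
move=> e /aB[f [mf f01 cf] fB]; exists (fun x => 1 - f x)%R.
  split; first exact: measurable_funB.
    by move=> x; have /andP[f0 f1] := f01 x; apply/andP; split; lra.
  move=> del /cf[r r0 fr]; exists r => // x y /fr.
  by rewrite (_ : 1 - f x - (1 - f y) = - (f x - f y))%R ?normrN//; ring.
rewrite (le_trans _ fB)// le_eqVlt; apply/orP; left; apply/eqP.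
apply: eq_integral => x _; congr EFin; rewrite !indicE in_setC.
case: (x \in B) => /=; first by rewrite subr0 distrC.
by rewrite subr0 addrAC subrr add0r normrN.
Qed.

Lemma approximableU B1 B2 : approximable B1 -> approximable B2 ->
  approximable (B1 `|` B2).
Proof.
move=> [mB1 aB1] [mB2 aB2]; split; first exact: measurableU.
move=> e e0; have e20 : (0 < e / 2)%R by rewrite divr_gt0.
have [f [mf f01 cf] fB1] := aB1 _ e20; have [g [mg g01 cg] gB2] := aB2 _ e20.
exists (fun x => Num.max (f x) (g x)).
  split; first exact: measurable_maxr.
    move=> x; have /andP[f0 f1] := f01 x; have /andP[g0 g1] := g01 x.
    by rewrite le_max f0/= ge_max f1.
  move=> r r0; have r20 : (0 < r / 2)%R by rewrite divr_gt0.
  have [r1 r10 fr1] := cf _ r20; have [r2 r20' gr2] := cg _ r20.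
  exists (Num.min r1 r2); first by rewrite lt_min r10.
  move=> x y xy; apply: le_trans (max_dist _ _ _ _) _.
  rewrite (splitr r) lerD//; [apply: fr1|apply: gr2] => k;
    by have := xy k; rewrite le_min => /andP[].
have := @le_dist f \1_B1 g \1_B2 mf (measurable_indic mB1) mg (measurable_indic mB2).
move=> /(_ (fun x => Num.max (f x) (g x)) \1_(B1 `|` B2)) le.
apply: le_trans (le _ _ _) _.
- exact: measurable_maxr.
- exact/measurable_indic/measurableU.
- move=> x; have -> : \1_(B1 `|` B2) x = Num.max (\1_B1 x) (\1_B2 x) :> R.
    by rewrite !indicE in_setU; case: (x \in B1); case: (x \in B2);
       rewrite ?maxxx ?(max_l ler01) ?(max_r ler01).
  exact: max_dist.
- by rewrite (splitr e) EFinD leeD.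
Qed.

(** Finite unions approximate the countable union in measure, by continuity of
[Q] along decreasing sets. *)
Lemma approximable_bigcup (F : (set (d.-tuple R))^nat) :
  (forall n, approximable (F n)) -> approximable (\bigcup_n F n).
Proof.
move=> aF; have mF n : measurable (F n) by case: (aF n).
pose U n := \big[setU/set0]_(k < n) F k.
have aU n : approximable (U n).
  elim: n => [|n IH]; rewrite /U ?big_ord0 ?big_ord_recr/=.
    exact: approximable0.
  exact: approximableU.
have mU n : measurable (U n) by case: (aU n).
have mUF : measurable (\bigcup_n F n) by exact: bigcupT_measurable.
split => // e e0; have e20 : (0 < e / 2)%R by rewrite divr_gt0.
have : Q (\bigcap_n (\bigcup_n F n `\` U n)) = 0.
  rewrite (_ : \bigcap_n _ = set0) ?measure0// -subset0 => x /= xU.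
  have [[n _ Fnx] _] := xU 0%N Logic.I.
  have [_] := xU n.+1 Logic.I; apply.
  by rewrite /U big_ord_recr; right.
move=> Q0; have : Q \o (fun n => \bigcup_n F n `\` U n) @ \oo -->
    Q (\bigcap_n (\bigcup_n F n `\` U n)).
  apply: nonincreasing_cvg_mu.
  - apply: le_lt_trans (ltry 1%R); apply: probability_le1; exact: measurableD.
  - by move=> n; exact: measurableD.
  - by apply: bigcapT_measurable => n; exact: measurableD.
  - move=> m n mn; apply/subsetPset; apply: setDS.
    by apply: subset_bigsetU.
rewrite Q0 => /fine_cvgP[fin_near].
move=> /cvgr_le/(_ _ e20)[N _ /(_ N (leqnn N))/= small].
have {}small : Q (\bigcup_n F n `\` U N) <= (e / 2)%:E.
  by rewrite -[leLHS]fineK ?lee_fin// fin_num_measure//; exact: measurableD.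
have [f [mf f01 cf] fU] := (aU N).2 _ e20.
exists f => //.
have := @le_dist f \1_(U N) \1_(U N) \1_(\bigcup_n F n) mf
  (measurable_indic (mU N)) (measurable_indic (mU N)) (measurable_indic mUF).
move=> /(_ f \1_(\bigcup_n F n) mf (measurable_indic mUF)) le.
apply: le_trans (le _) _ => [x|]; first exact: ler_distD.
rewrite (splitr e) EFinD leeD//; apply: le_trans small.
rewrite -[X in Q X]setIT -integral_indic//; last exact: measurableD.
rewrite le_eqVlt; apply/orP; left; apply/eqP.
apply: eq_integral => x _; congr EFin; rewrite !indicE in_setD.
have [/set_mem xU|xU] := boolP (x \in U N).
  rewrite andbF mem_set ?subrr ?normr0//.
  move: xU; rewrite /U -bigcup_mkord => -[k _ Fkx]; by exists k.
by rewrite andbT sub0r normrN ger0_norm.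
Qed.
(** A steep ramp differs from the indicator only on a slab above the hyperplane.
The slabs shrink to the empty set, since they avoid the hyperplane itself, which
may be charged by [Q]. *)
Lemma approximable_ray (k : 'I_d) (a : R) :
  approximable ((fun x => tnth x k) @^-1` `]a, +oo[).
Proof.
have mk : measurable_fun setT (fun x : d.-tuple R => tnth x k) by exact: measurable_tnth.
have mI (I : interval R) : measurable ((fun x : d.-tuple R => tnth x k) @^-1` [set` I]).
  by rewrite -[X in measurable X]setTI; apply: mk.
split; first exact: mI.
move=> e e0; pose S n := (fun x : d.-tuple R => tnth x k) @^-1` `]a, (a + n.+1%:R^-1)%R].
have : Q \o S @ \oo --> Q (\bigcap_n S n).
  apply: nonincreasing_cvg_mu.
  - by apply: le_lt_trans (ltry 1%R); apply: probability_le1; exact: mI.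
  - by move=> n; exact: mI.
  - by apply: bigcapT_measurable => n; exact: mI.
  - move=> m n mn; apply/subsetPset => x; rewrite /S/= !in_itv/= => /andP[-> xn]/=.
    by apply: le_trans xn _; rewrite lerD2l lef_pV2 ?posrE// ler_nat.
have -> : \bigcap_n S n = set0.
  rewrite -subset0 => x xS.
  have /andP[ax _] : (a < tnth x k <= a + 1%:R^-1)%R by have := xS 0%N Logic.I; rewrite /S/= in_itv.
  have xa0 : (0 < tnth x k - a)%R by rewrite subr_gt0.
  have [n nx] := ltr_add_invr ax.
  have := xS n Logic.I; rewrite /S/= in_itv/= => /andP[_].
  by rewrite leNgt nx.
rewrite measure0 => /fine_cvgP[_ /cvgr_le/(_ _ e0)[N _ /(_ N (leqnn N))/= small]].
have {}small : Q (S N) <= e%:E.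
  by rewrite -[leLHS]fineK ?lee_fin// fin_num_measure//; exact: mI.
pose s : R := N.+1%:R; have s0 : (0 < s)%R by [].
pose f (x : d.-tuple R) := Num.max 0%R (Num.min 1%R (s * (tnth x k - a)))%R.
have fsmooth : smooth_indicator f; last exists f => //.
  split.
  - apply: measurable_maxr => //; apply: measurable_minr => //.
    by apply: measurable_funM => //; exact: measurable_funB.
  - by move=> x; rewrite le_max lexx/= ge_max ler01/= ge_min lexx.
  - move=> r r0; exists (r / s)%R; first by rewrite divr_gt0.
    move=> x y /(_ k) xy; apply: le_trans (max_dist _ _ _ _) _.
    have min_max (u v : R) : Num.min u v = (- Num.max (- u) (- v))%R.
      by rewrite oppr_max !opprK.
    rewrite subrr normr0 add0r !min_max -opprD normrN.
    apply: le_trans (max_dist _ _ _ _) _.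
    rewrite subrr normr0 add0r.
    rewrite (_ : _ - _ = s * (tnth y k - tnth x k))%R; last by ring.
    by rewrite normrM (gtr0_norm s0) distrC mulrC -ler_pdivlMr.
rewrite (le_trans _ small)// -[X in Q X]setIT -integral_indic//; last exact: mI.
apply: ge0_le_integral => //.
- apply: mdist; first by case: fsmooth.
  by apply: measurable_indic; exact: mI.
- by apply/measurable_EFinP; apply: measurable_indic; exact: mI.
move=> x _; rewrite lee_fin !indicE /S /f.
have [xa|ax] := leP (tnth x k) a.
  rewrite memNset; last by rewrite /= in_itv/= andbT ltNge xa.
  rewrite subr0 ger0_norm ?le_max ?lexx// max_l ?ler0n//.
  by rewrite ge_min mulr_ge0_le0 ?orbT ?subr_le0// ltW.
have -> : (x \in (fun x => tnth x k) @^-1` `]a, +oo[) = true.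
  by rewrite mem_set//= in_itv/= andbT.
have u0 : (0 < s * (tnth x k - a))%R by rewrite mulr_gt0// subr_gt0.
rewrite max_r; last by rewrite le_min ler01 ltW.
have [xs|xs] := leP (tnth x k) (a + s^-1)%R.
  rewrite mem_set; last by rewrite /= in_itv/= ax.
  have : (Num.min 1 (s * (tnth x k - a)) <= 1)%R by rewrite ge_min lexx.
  have : (0 < Num.min 1 (s * (tnth x k - a)))%R by rewrite lt_min u0 ltr01.
  by move: (Num.min _ _) => v v0 v1; rewrite ler_norml/=; apply/andP; split; lra.
rewrite min_l ?subrr ?normr0//.
by rewrite mulrC -ler_pdivrMr// div1r lerBrDl ltW.
Qed.

(** Approximable sets form a sigma-algebra, and it contains the coordinate
half-spaces, which generate the Borel sets. *)
Lemma approximable_measurable B : measurable B -> approximable B.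
Proof.
have sigma : sigma_algebra setT approximable.
  split; first exact: approximable0.
    by move=> A; rewrite setTD; exact: approximableC.
  exact: approximable_bigcup.
apply: smallest_sub => //.
apply: (big_ind (fun G => G `<=` approximable)) => // [G1 G2|k _].
  by move=> G1a G2a A [/G1a|/G2a].
move=> _ [V mV <-]; pose coord x := @tnth d R x k.
suff : @measurable _ R `<=` image_set_system setT coord approximable by exact.
rewrite [X in X `<=` _]RGenOInfty.measurableE.
apply: smallest_sub; first exact: sigma_algebra_image.
by move=> _ [a ->]; rewrite /image_set_system/= setTI; exact: approximable_ray.
Qed.

End borel_approximation.

(** * Conditional error probability *)

Lemma pblock_index_unique {T : Type} (A : nat -> set T) (j : nat) (x : T) :
  trivIset setT A -> A j x -> pblock_index setT A x = j.
Proof.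
move=> tA Ajx; rewrite /pblock_index.
have [_ Ax] : [set: nat] [get i | [set: nat] i /\ A i x] /\
    A [get i | [set: nat] i /\ A i x] x.
  exact: (@getPex _ (fun i => [set: nat] i /\ A i x) (ex_intro _ j (conj Logic.I Ajx))).
by apply: tA => //; exists x.
Qed.

Section conditional_probability.
Local Open Scope ereal_scope.
Context {R : realType} {disp : measure_display} {Omega : measurableType disp}.
Variables (P : probability Omega R) (G0 : set (set Omega)).
Hypothesis G0_measurable : <<s G0 >> `<=` measurable.
Let G := <<s G0 >>.

Let measurable_sub (L : Omega -> R) : (forall V, measurable V -> G (L @^-1` V)) ->
  measurable_fun (setT : set (g_sigma_algebraType G0)) (L : g_sigma_algebraType G0 -> R).
Proof. by move=> mL _ V mV; rewrite setTI; exact: mL. Qed.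

Let cond_prob_le (E : set Omega) (L1 L2 : Omega -> R) :
  measurable E -> is_cond_prob P G E L1 -> is_cond_prob P G E L2 ->
  {ae P, forall w, (L1 w <= L2 w)%R}.
Proof.
move=> mE [m1 i1 e1] [m2 i2 e2].
pose U := [set w | (0 < L1 w - L2 w)%R].
have GU : G U.
  have : measurable_fun setT ((L1 : g_sigma_algebraType G0 -> R) \- L2)%R.
    by apply: measurable_funB; exact: measurable_sub.
  move=> /(_ measurableT `]0%R, +oo[%classic (measurable_itv _)).
  rewrite setTI (_ : _ @^-1` _ = U)//.
  by apply/seteqP; split => w; rewrite /U/= in_itv/= andbT.
have mU : measurable U by exact: G0_measurable.
have iU1 : P.-integrable U (EFin \o L1) by apply: integrableS i1.
have iU2 : P.-integrable U (EFin \o L2) by apply: integrableS i2.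
have int0 : \int[P]_(w in U) (L1 w - L2 w)%:E = 0.
  under eq_integral do rewrite EFinB.
  rewrite integralB// e1// e2// subee//; apply: fin_num_measure.
  exact: measurableI.
have mL : measurable_fun U (EFin \o (L1 \- L2)%R).
  by have /integrableP[] := integrableB mU iU1 iU2.
have : \int[P]_(w in U) `|(EFin \o (L1 \- L2)%R) w| = 0.
  rewrite -[RHS]int0; apply: eq_integral => w; rewrite inE => Uw.
  by rewrite gee0_abs//= lee_fin ltW.
move=> /(ae_eq_integral_abs P mU mL).
apply: filterS => w Uw; rewrite leNgt -subr_gt0; apply/negP => Lw.
by have /= [/eqP] := Uw Lw; rewrite gt_eqF.
Qed.

(** If one version exceeded the other with positive probability, it would have
the larger integral over the event where this happens, which lies in the
conditioning sigma-algebra. *)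
Lemma cond_prob_unique (E : set Omega) (L1 L2 : Omega -> R) :
  measurable E -> is_cond_prob P G E L1 -> is_cond_prob P G E L2 ->
  {ae P, forall w, L1 w = L2 w}.
Proof.
move=> mE c1 c2; have := cond_prob_le mE c1 c2; have := cond_prob_le mE c2 c1.
by apply: filterS2 => w le21 le12; apply/le_anti/andP.
Qed.

Section test_pair.
Context {d' : measure_display} {T : measurableType d'}.
Variables (X : {RV P >-> T}) (Y : {RV P >-> R}) (A : nat -> set T).
Hypothesis Y1 : forall w, Y w = 1%R \/ Y w = (-1)%R.
Hypothesis mA : forall j, measurable (A j).
Hypothesis tA : trivIset setT A.
Hypothesis cA : forall x, exists j, A j x.
Hypothesis indepXY : independent P (sigma_rv (fun w => (X w, Y w))) G.
Variable v : nat -> Omega -> R.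
Hypothesis mv : forall j V, measurable V -> G (v j @^-1` V).

Let rule (w : Omega) (x : T) : R := sign_pm (v (pblock_index setT A x) w).

Let Q (j : nat) (y : R) : set Omega := [set w | A j (X w) /\ Y w = y].

Let mQ j y : measurable (Q j y).
Proof.
rewrite (_ : Q j y = (X @^-1` A j) `&` (Y @^-1` [set y])); last by [].
by apply: measurableI; exact: measurable_funPTI.
Qed.

Let G_measurable B : G B -> measurable B. Proof. exact: G0_measurable. Qed.

Let indepQ j y B : G B -> P (B `&` Q j y) = P B * P (Q j y).
Proof.
move=> GB; rewrite setIC muleC; apply: indepXY => //.
exists (A j `*` [set y]); first exact: measurableX.
by rewrite setTI.
Qed.

Let pos j : set Omega := [set w | (0 < v j w)%R].

Let Gpos j : G (pos j).
Proof.
rewrite (_ : pos j = v j @^-1` `]0%R, +oo[); first by apply: mv.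
by apply/seteqP; split => w; rewrite /pos/= in_itv/= andbT.
Qed.

Let GposC j : G (~` pos j).
Proof. exact: (@measurableC _ (g_sigma_algebraType G0) _ (Gpos j)). Qed.

Let phi j w : R :=
  (\1_(pos j) w * fine (P (Q j (-1)%R)) + \1_(~` pos j) w * fine (P (Q j 1%R)))%R.

Let phi_ge0 j w : (0 <= phi j w)%R.
Proof. by rewrite addr_ge0// mulr_ge0// fine_ge0. Qed.

Let measure_cells (E : set Omega) : measurable E ->
  P E = \sum_(0 <= j <oo) (P (E `&` (X @^-1` A j))).
Proof.
move=> mE; have mXA j : measurable (X @^-1` A j) by exact: measurable_funPTI.
transitivity (P (\bigcup_j (E `&` X @^-1` A j))).
  congr (P _); rewrite -setI_bigcupr -[LHS]setIT; congr (_ `&` _).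
  apply/seteqP; split => // w _; have [j Aj] := cA (X w); by exists j.
rewrite measure_bigcup//.
- by apply: eq_eseriesl => j; rewrite in_setT.
- by move=> j _; exact: measurableI.
- move=> i j _ _ [w [[_ Ai] [_ Aj]]]; apply: (tA Logic.I Logic.I).
  by exists (X w).
Qed.

Let rule_error w w' j : A j (X w') ->
  (rule w (X w') != Y w') = (Y w' == if (0 < v j w)%R then (-1)%R else 1%R).
Proof.
move=> Aj; rewrite /rule (pblock_index_unique tA Aj) /sign_pm.
have n11 : (1 == -1 :> R)%R = false by apply/negbTE/eqP => e; lra.
have n11' : (-1 == 1 :> R)%R = false by rewrite eq_sym.
by case: ifP => _; have [->|->] := Y1 w'; rewrite ?eqxx ?n11 ?n11'.
Qed.

Let cell_error (w : Omega) := [set w' | rule w (X w') != Y w'].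

Let cell_errorE w j : cell_error w `&` (X @^-1` A j) =
  Q j (if (0 < v j w)%R then (-1)%R else 1%R).
Proof.
apply/seteqP; split => w' /=.
  by move=> [+ Aj]; rewrite /cell_error/= (rule_error _ Aj) => /eqP.
by move=> [Aj Yw]; rewrite /cell_error/= (rule_error _ Aj) Yw eqxx.
Qed.

Lemma measurable_cell_error w : measurable (cell_error w).
Proof.
rewrite (_ : cell_error w = \bigcup_j Q j (if (0 < v j w)%R then (-1)%R else 1%R)).
  exact: bigcupT_measurable.
apply/seteqP; split => w'.
  by move=> Ew; have [j Aj] := cA (X w'); exists j => //; rewrite -cell_errorE.
by move=> [j _]; rewrite -cell_errorE => -[].
Qed.

Let riskE w : (error_prob P X Y (rule w))%:E = \sum_(0 <= j <oo) (phi j w)%:E.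
Proof.
rewrite /error_prob fineK; last by apply: fin_num_measure; exact: measurable_cell_error.
rewrite (measure_cells (measurable_cell_error w)).
apply: eq_eseriesr => j _; rewrite cell_errorE /phi !indicE in_setC.
have fQ y : (fine (P (Q j y)))%:E = P (Q j y) by rewrite fineK// fin_num_measure.
have [vj|vj] := boolP (0 < v j w)%R.
  by rewrite mem_set//= mul1r mul0r addr0 fQ.
by rewrite memNset/= ?mul1r ?mul0r ?add0r ?fQ//; exact/negP.
Qed.

Let random_error := [set w | rule w (X w) != Y w].

Let random_errorE j : random_error `&` (X @^-1` A j) =
  (pos j `&` Q j (-1)%R) `|` (~` pos j `&` Q j 1%R).
Proof.
apply/seteqP; split => w /=.
  move=> [+ Aj]; rewrite /random_error/= (rule_error _ Aj).
  by case: ifP => vj /eqP Yw; [left|right]; split => //; rewrite /pos/= vj.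
case=> -[vj [Aj Yw]]; split => //; rewrite /random_error/= (rule_error _ Aj) Yw.
  by rewrite ifT.
by rewrite ifF//; exact/negP.
Qed.

Lemma measurable_random_error : measurable random_error.
Proof.
rewrite (_ : random_error = \bigcup_j (random_error `&` (X @^-1` A j))).
  apply: bigcupT_measurable => j; rewrite random_errorE.
  by apply: measurableU; apply: measurableI => //; exact: G_measurable.
apply/seteqP; split => w; last by case=> j _ [].
by move=> Ew; have [j Aj] := cA (X w); exists j.
Qed.

(** Given the data the rule is constant on each cell, and the test pair is
independent of the data: so the conditional error probability is obtained by
freezing the data in the error probability, cell by cell. *)
Lemma error_prob_is_cond_prob :
  is_cond_prob P G random_error (fun w => error_prob P X Y (rule w)).
Proof.
have mphi j : measurable_fun setT (phi j : g_sigma_algebraType G0 -> R).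
  apply: measurable_funD; apply: measurable_funM => //.
    exact: (@measurable_indic _ (g_sigma_algebraType G0) R setT _ (Gpos j)).
  exact: (@measurable_indic _ (g_sigma_algebraType G0) R setT _ (GposC j)).
have mrisk : measurable_fun setT
    ((fun w => error_prob P X Y (rule w)) : g_sigma_algebraType G0 -> R).
  apply/measurable_EFinP.
  rewrite (_ : _ \o _ = fun w => \sum_(0 <= j <oo) (phi j w)%:E); last first.
    by apply/funext => w /=; rewrite riskE.
  apply: ge0_emeasurable_sum => [j w _ _|j _]; first by rewrite lee_fin.
  exact/measurable_EFinP.
have mriskP : measurable_fun setT (fun w => error_prob P X Y (rule w)).
  move=> _ V mV; apply: G_measurable; exact: mrisk.
split.
- by move=> V mV; have := mrisk measurableT V mV; rewrite setTI.
- apply: measurable_bounded_integrable => //.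
    by apply: le_lt_trans (ltry 1%R); exact: probability_le1.
  exists 1%R; split; first exact: num_real.
  move=> M M1 w _; rewrite /= ger0_norm ?fine_ge0//.
  apply: le_trans (ltW M1); rewrite -lee_fin fineK.
    by apply: probability_le1; exact: measurable_cell_error.
  by apply: fin_num_measure; exact: measurable_cell_error.
- move=> B GB; under eq_integral do rewrite riskE.
  have mB := G_measurable GB.
  have mpos := G_measurable (Gpos _); have mposC := G_measurable (GposC _).
  rewrite integral_nneseries//; last 2 first.
  + move=> j; apply/measurable_EFinP; apply: measurable_funTS.
    by move=> _ V mV; apply: G_measurable; exact: mphi.
  + by move=> j w _; rewrite lee_fin.
  rewrite [RHS]measure_cells; last first.
    by apply: measurableI => //; exact: measurable_random_error.
  apply: eq_eseriesr => j _; rewrite -setIA random_errorE setIUr.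
  rewrite measureU//; last 3 first.
  + by apply: measurableI => //; exact: measurableI.
  + by apply: measurableI => //; exact: measurableI.
  + by rewrite -subset0 => w [[_ [vj _]] [_ [nvj _]]].
  have GI E : G E -> G (B `&` E).
    exact: (@measurableI _ (g_sigma_algebraType G0) _ _ GB).
  transitivity (P (B `&` pos j) * P (Q j (-1)%R) +
                P (B `&` ~` pos j) * P (Q j 1%R)); last first.
    apply: (congr2 adde); rewrite setIA; apply/esym.
      exact: (indepQ j _ (GI _ (Gpos j))).
    exact: (indepQ j _ (GI _ (GposC j))).
  have int_ind y E : measurable E ->
      \int[P]_(w in B) (\1_E w * fine (P (Q j y)))%:E = P (B `&` E) * P (Q j y).
    move=> mE; under eq_integral do rewrite EFinM.
    rewrite ge0_integralZr//; last 2 first.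
    * by apply/measurable_EFinP; exact: measurable_indic.
    * by rewrite lee_fin fine_ge0.
    by rewrite integral_indic// setIC fineK//; exact: fin_num_measure.
  have mind y E : measurable E ->
      measurable_fun B (fun w => (\1_E w * fine (P (Q j y)))%:E).
    by move=> mE; apply/measurable_EFinP/measurable_funM.
  under eq_integral do rewrite EFinD.
  rewrite ge0_integralD//.
  + by congr (_ + _); exact: int_ind.
  + by move=> w _; rewrite lee_fin mulr_ge0// fine_ge0.
  + exact: mind.
  + by move=> w _; rewrite lee_fin mulr_ge0// fine_ge0.
  + exact: mind.
Qed.

End test_pair.
End conditional_probability.

(** * Error probabilities as signed means *)

Lemma measurable_gt0 {R : realType} {d : measure_display} {T : measurableType d}
    (f : T -> R) : measurable_fun setT f -> measurable [set x | 0 < f x].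
Proof.
move=> mf; rewrite (_ : [set x | _] = f @^-1` `]0, +oo[).
  by rewrite -[X in measurable X]setTI; apply: mf.
by apply/seteqP; split => x /=; rewrite in_itv/= andbT.
Qed.

Lemma measurable_norm_ge {R : realType} {d : measure_display}
    {T : measurableType d} (f : T -> R) (c : R) :
  measurable_fun setT f -> measurable [set x | c <= `|f x|].
Proof.
move=> mf; rewrite -[X in measurable X]setTI.
apply: (@measurable_fun_le _ T R setT (cst c) (fun x => `|f x|)) => //.
exact: measurableT_comp.
Qed.


Lemma measurable_cellwise {R : realType} {d : measure_display}
    {T : measurableType d} (A : nat -> set T) (v : nat -> R) :
  (forall j, measurable (A j)) -> trivIset setT A -> (forall x, exists j, A j x) ->
  measurable [set x | 0 < v (pblock_index setT A x)].
Proof.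
move=> mA tA cA; set G := [set x | _].
rewrite (_ : G = \bigcup_(j in [set j | 0 < v j]) A j).
  by apply: bigcup_measurable => j _; exact: mA.
apply/seteqP; split => x.
  by have [j Aj] := cA x; rewrite /G/= (pblock_index_unique tA Aj) => vj; exists j.
by move=> [j /= vj Aj]; rewrite /G/= (pblock_index_unique tA Aj).
Qed.

Section signed_mean.
Context {R : realType} {disp d' : measure_display} {Omega : measurableType disp}.
Context {T : measurableType d'} (P : probability Omega R).
Variables (X : {RV P >-> T}) (Y : {RV P >-> R}).
Hypothesis Y1 : forall w, Y w = 1 \/ Y w = -1.
Implicit Types (f g : T -> R) (B : set T).

(** This is the integral of [f] against the signed measure that gives [B] the
mass [P (X in B, Y = 1) - P (X in B, Y = -1)]; its values on cells are what
[nu_tilde] estimates. *)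
Definition signed_mean f : R := \int[P]_w (Y w * f (X w)).

Let bdd f := measurable_fun setT f /\ exists M, forall x, `|f x| <= M.

Let Y_le1 w : `|Y w| = 1.
Proof. by case: (Y1 w) => ->; rewrite ?normrN normr1. Qed.

Lemma integrable_bounded (f : Omega -> R) (M : R) :
  measurable_fun setT f -> (forall w, `|f w| <= M) ->
  P.-integrable setT (EFin \o f).
Proof.
move=> mf fM; apply: measurable_bounded_integrable => //.
  by apply: le_lt_trans (ltry 1); exact: probability_le1.
exists M; split; first exact: num_real.
by move=> N MN w _; apply: le_trans (fM w) (ltW MN).
Qed.

Let integrable_Y f : bdd f -> P.-integrable setT (EFin \o (fun w => Y w * f (X w))).
Proof.
move=> [mf [M fM]]; apply: (@integrable_bounded _ M).
  by apply: measurable_funM => //; exact: measurableT_comp.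
by move=> w; rewrite normrM Y_le1 mul1r.
Qed.

Let bddB f g : bdd f -> bdd g -> bdd (fun x => f x - g x).
Proof.
move=> [mf [M fM]] [mg [N gN]]; split; first exact: measurable_funB.
by exists (M + N) => x; apply: le_trans (ler_normB _ _) (lerD _ _).
Qed.

Let bdd_indic B : measurable B -> bdd \1_B.
Proof.
move=> mB; split; first exact: measurable_indic.
by exists 1 => x; rewrite indicE ger0_norm// lern1 leq_b1.
Qed.

Let bddM c f : bdd f -> bdd (fun x => c * f x).
Proof.
move=> [mf [M fM]]; split; first exact: measurable_funM.
by exists (`|c| * M) => x; rewrite normrM ler_wpM2l.
Qed.

Let bddD f g : bdd f -> bdd g -> bdd (fun x => f x + g x).
Proof.
move=> [mf [M fM]] [mg [N gN]]; split; first exact: measurable_funD.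
by exists (M + N) => x; apply: le_trans (ler_normD _ _) (lerD _ _).
Qed.

Let bdd_cells (s : seq nat) (c : nat -> R) (A : nat -> set T) :
  (forall j, measurable (A j)) -> bdd (fun x => \sum_(j <- s) c j * \1_(A j) x).
Proof.
move=> mA; elim: s => [|j s IH].
  under eq_fun do rewrite big_nil.
  by split => //; exists 0 => x; rewrite normr0.
under eq_fun do rewrite big_cons.
by apply: bddD => //; apply: bddM; exact: bdd_indic.
Qed.

Let signed_mean_sub f g (c : R) : bdd f -> bdd g ->
  (\int[P]_w (`|f (X w) - g (X w)|)%:E <= c%:E)%E ->
  signed_mean f - signed_mean g <= c.
Proof.
move=> bf bg fg; rewrite /signed_mean -RintegralB//; [|exact: integrable_Y|exact: integrable_Y].
have bfg := bddB bf bg; have ifg := integrable_Y bfg.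
have mX : measurable_fun setT (fun w => f (X w) - g (X w)).
  exact: (measurableT_comp bfg.1 (measurable_funP X)).
have -> : \int[P]_w (Y w * f (X w) - Y w * g (X w)) =
    \int[P]_w (Y w * (f (X w) - g (X w))).
  by apply: eq_Rintegral => w _; rewrite mulrBr.
apply: le_trans (ler_norm _) _; apply: le_trans (le_normr_Rintegral _ _) _ => //.
rewrite -lee_fin /Rintegral fineK.
  apply: le_trans fg; apply: ge0_le_integral => //.
  - by apply/measurable_EFinP; apply: measurableT_comp => //; exact: measurable_funM.
  - by apply/measurable_EFinP; exact: measurableT_comp.
  - by move=> w _; rewrite lee_fin normrM Y_le1 mul1r.
rewrite ge0_fin_numE; last by apply: integral_ge0 => w _; rewrite lee_fin.
by have /integrableP[_] := ifg.
Qed.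

Let signed_mean_cells (s : seq nat) (c : nat -> R) (A : nat -> set T) :
  (forall j, measurable (A j)) ->
  signed_mean (fun x => \sum_(j <- s) c j * \1_(A j) x) =
  \sum_(j <- s) c j * signed_mean \1_(A j).
Proof.
move=> mA; elim: s => [|j s IH].
  rewrite big_nil /signed_mean; under eq_Rintegral do rewrite big_nil mulr0.
  by rewrite Rintegral_cst// mul0r.
rewrite big_cons -IH /signed_mean -RintegralZl//; last first.
  by apply: integrable_Y; exact: bdd_indic.
rewrite -RintegralD//; last 2 first.
- rewrite (_ : _ \o _ = EFin \o (fun w => Y w * (c j * \1_(A j) (X w)))).
    exact: (integrable_Y (bddM (c j) (bdd_indic (mA j)))).
  by apply/funext => w /=; rewrite mulrCA.
- exact: (integrable_Y (bdd_cells s c mA)).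
by apply: eq_Rintegral => w _; rewrite big_cons mulrDr mulrCA.
Qed.

Lemma prob_complement_integral B : measurable B ->
  (\int[P]_w (\1_(~` B) (X w))%:E = P (X @^-1` (~` B)))%E.
Proof.
move=> mB; rewrite -[X in P X]setIT -integral_indic//.
by apply: measurable_funPTI; exact: measurableC.
Qed.

(** The path from [\1_D] to the rule visits the approximation [f], its
discretisation [psi c] on the cells listed in [s], and the rule [psi b] on these
cells. Only the passage from [psi c] to [psi b] is statistical. It costs at most
[t] per cell: a weight [c j] in the unit interval beats the decision taken from
[v j] only if the cell mass [nu] is negative and [v j] positive, or [nu] is
positive and [v j] is not; and then [`|nu|] is at most [`|v j - nu|]. *)
Lemma plug_in_comparison (D : set T) (f : T -> R) (A : nat -> set T) (s : seq nat)
    (v : nat -> R) (t del : R) :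
  measurable D -> measurable_fun setT f -> (forall x, 0 <= f x <= 1) ->
  (forall j, measurable (A j)) -> trivIset setT A -> (forall x, exists j, A j x) ->
  uniq s -> 0 <= del ->
  (\int[P]_w (`|f (X w) - \1_D (X w)|)%:E <= del%:E)%E ->
  (forall j x y, A j x -> A j y -> `|f x - f y| <= del) ->
  (P (X @^-1` (~` \bigcup_(j in [set` s]) A j)) <= del%:E)%E ->
  (forall j, j \in s -> `|v j - signed_mean \1_(A j)| <= t) ->
  signed_mean \1_D - signed_mean \1_[set x | 0 < v (pblock_index setT A x)] <=
    4 * del + t * (size s)%:R.
Proof.
move=> mD mf f01 mA tA cA us del0 fD osc PU vt.
set G := [set x | _].
have inE j x : A j x -> pblock_index setT A x = j by exact: pblock_index_unique.
have mG : measurable G by exact: measurable_cellwise.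
pose U := \bigcup_(j in [set` s]) A j.
have mU : measurable U by apply: bigcup_measurable => j _; exact: mA.
have /choice[c cP] j : exists c, (0 <= c <= 1) /\ forall x, A j x -> `|f x - c| <= del.
  have [[y Ay]|nA] := pselect (exists y, A j y).
    by exists (f y); split => // x Ax; exact: (osc j).
  by exists 0; split; [rewrite lexx ler01|move=> x Ax; case: nA; exists x].
pose b j : R := (0 < v j)%R%:R.
pose psi (a : nat -> R) x := \sum_(j <- s) a j * \1_(A j) x.
have psiE a j x : A j x -> psi a x = if j \in s then a j else 0.
  move=> Aj; rewrite /psi; case: ifPn => js.
    rewrite (bigD1_seq j)//= indicE mem_set// mulr1 big1 ?addr0// => i ij.
    rewrite indicE memNset ?mulr0// => Ai; move/eqP : ij; apply.
    by apply: (tA i j) => //; exists x.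
  rewrite big_seq big1// => i is_; rewrite indicE memNset ?mulr0// => Ai.
  by move: js; rewrite -(tA i j) ?is_//; exists x.
have UE j x : A j x -> \1_(~` U) x = (j \notin s)%:R :> R.
  move=> Aj; rewrite indicE; case: (boolP (j \in s)) => js /=.
    by rewrite memNset//= => nU; apply: nU; exists j.
  rewrite mem_set// => -[i /= is_ Ai]; move: js.
  by rewrite -(tA i j) ?is_//; exists x.
have bf : bdd f.
  by split => //; exists 1 => x; have /andP[f0 f1] := f01 x; rewrite ger0_norm.
have mpsi a : measurable_fun setT (psi a) by apply: (bdd_cells _ _ _).1.
have bpsi a : bdd (psi a) by exact: bdd_cells.
have mUX : measurable_fun setT (fun w => \1_(~` U) (X w) : R).
  apply: measurableT_comp => //; apply: measurable_indic; exact: measurableC.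
have step1 : signed_mean \1_D - signed_mean f <= del.
  apply: signed_mean_sub => //; first exact: bdd_indic.
  by under eq_integral do rewrite distrC.
have step2 : signed_mean f - signed_mean (psi c) <= 2 * del.
  apply: signed_mean_sub => //.
  apply: (@le_trans _ _ (\int[P]_w (del%:E + (\1_(~` U) (X w))%:E))%E).
    apply: ge0_le_integral => //.
    - apply/measurable_EFinP; apply: measurableT_comp => //.
      by apply: measurable_funB; exact: measurableT_comp.
    - by apply: emeasurable_funD => //; exact/measurable_EFinP.
    - move=> w _; rewrite lee_fin; have [j Aj] := cA (X w).
      rewrite (psiE _ _ _ Aj) (UE _ _ Aj); have [c01 cf] := cP j.
      case: (j \in s) => /=; first by rewrite addr0 cf.
      by rewrite subr0; have /andP[f0 f1] := f01 (X w); rewrite ger0_norm// ler_wpDl.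
  rewrite ge0_integralD//; last exact/measurable_EFinP.
  rewrite integral_cst// prob_complement_integral// mulr_natl mulr2n EFinD leeD//.
  by rewrite -[leRHS]mule1 lee_wpmul2l//; exact: probability_le1.
have step3 : signed_mean (psi c) - signed_mean (psi b) <= t * (size s)%:R.
  rewrite !signed_mean_cells// -sumrB -sum1_size natr_sum mulr_sumr big_seq
    [leRHS]big_seq; apply: ler_sum => j js.
  have [/andP[c0 c1] _] := cP j; have := vt _ js.
  move: (signed_mean _) (c j) c0 c1 => nu cj c0 c1; rewrite mulr1 ler_norml /b.
  by move=> /andP[v1 v2]; have [vj|vj] := ltP 0 (v j); rewrite ?mul1r ?mul0r; nra.
have step4 : signed_mean (psi b) - signed_mean \1_G <= del.
  apply: signed_mean_sub => //; first exact: bdd_indic.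
  apply: le_trans PU; rewrite -prob_complement_integral//.
  apply: ge0_le_integral => //.
  - apply/measurable_EFinP; apply: measurableT_comp => //.
    apply: measurable_funB; first exact: measurableT_comp.
    by apply: measurableT_comp => //; exact: measurable_indic.
  - exact/measurable_EFinP.
  - move=> w _; rewrite lee_fin; have [j Aj] := cA (X w).
    rewrite (psiE _ _ _ Aj) (UE _ _ Aj).
    have -> : \1_G (X w) = b j :> R.
      rewrite indicE /b; congr (nat_of_bool _)%:R; apply/idP/idP => [/set_mem|vj].
        by rewrite /G/= (inE _ _ Aj) => ->.
      by apply/mem_set; rewrite /G/= (inE _ _ Aj).
    case: (j \in s) => /=; first by rewrite subrr normr0.
    by rewrite sub0r normrN /b; case: (0 < v j); rewrite ?normr1 ?normr0.
lra.
Qed.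

Let Q B y : set Omega := [set w | B (X w) /\ Y w = y].

Let mQ B y : measurable B -> measurable (Q B y).
Proof.
move=> mB; rewrite (_ : Q B y = (X @^-1` B) `&` (Y @^-1` [set y])); last by [].
by apply: measurableI; exact: measurable_funPTI.
Qed.

Let one_neq : (1 == -1 :> R) = false.
Proof. by apply/negbTE/eqP => e; lra. Qed.

Lemma signed_indicE B w : Y w * \1_B (X w) =
  \1_[set w | B (X w) /\ Y w = 1] w - \1_[set w | B (X w) /\ Y w = -1] w.
Proof.
rewrite -/(Q B 1) -/(Q B (-1)).
rewrite !indicE; have [/set_mem Bw|Bw] := boolP (X w \in B); last first.
  by rewrite mulr0 !memNset ?subrr//; move=> [Bw' _]; move/negP: Bw; apply; exact/mem_set.
rewrite mulr1; have [Yw|Yw] := Y1 w.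
  rewrite mem_set// memNset ?subr0// => -[_]; rewrite Yw => /eqP.
  by rewrite one_neq.
rewrite memNset ?mem_set ?sub0r// => -[_]; rewrite Yw => /eqP.
by rewrite eq_sym one_neq.
Qed.

Lemma signed_mean_indic B : measurable B ->
  signed_mean \1_B = fine (P [set w | B (X w) /\ Y w = 1]) -
                     fine (P [set w | B (X w) /\ Y w = -1]).
Proof.
move=> mB; rewrite -/(Q B 1) -/(Q B (-1)).
have ind y : \int[P]_w \1_(Q B y) w = fine (P (Q B y)).
  by rewrite /Rintegral integral_indic// ?setIT//; exact: mQ.
have int_ind y : P.-integrable setT (EFin \o \1_(Q B y)).
  apply: (@integrable_bounded _ 1); first exact/measurable_indic/mQ.
  by move=> w; rewrite indicE ger0_norm// lern1 leq_b1.
rewrite -!ind -RintegralB//; apply: eq_Rintegral => w _.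
exact: signed_indicE.
Qed.

(** Errors inside the set where the rule answers [1] cost mass of [Y = -1] and
errors outside cost mass of [Y = 1], so that minimising the error probability is
maximising [signed_mean]. *)
Lemma error_prob_signed_mean (u : T -> R) : measurable [set x | 0 < u x] ->
  error_prob P X Y (fun x => sign_pm (u x)) =
  fine (P (Y @^-1` [set 1])) - signed_mean \1_[set x | 0 < u x].
Proof.
set B := [set x | _] => mB; rewrite signed_mean_indic// -/(Q B 1) -/(Q B (-1)).
have mC : measurable (~` B) by exact: measurableC.
have YE : fine (P (Y @^-1` [set 1])) = fine (P (Q B 1)) + fine (P (Q (~` B) 1)).
  rewrite (_ : Y @^-1` [set 1] = Q B 1 `|` Q (~` B) 1).
    rewrite measureU; [|exact: mQ|exact: mQ|].
      by rewrite fineD//; apply: fin_num_measure; exact: mQ.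
    by rewrite -subset0 => w [[Bw _] [nBw _]].
  apply/seteqP; split => w /=; last by case=> -[].
  by move=> Yw; have [Bw|Bw] := pselect (B (X w)); [left|right].
have errE : error_prob P X Y (fun x => sign_pm (u x)) =
    fine (P (Q B (-1))) + fine (P (Q (~` B) 1)).
  rewrite /error_prob (_ : [set w | _] = Q B (-1) `|` Q (~` B) 1).
    rewrite measureU; [|exact: mQ|exact: mQ|].
      by rewrite fineD//; apply: fin_num_measure; exact: mQ.
    by rewrite -subset0 => w [[Bw _] [nBw _]].
  apply/seteqP; split => w /=; rewrite /sign_pm.
    case: ifPn => uw; have [Yw|Yw] := Y1 w; rewrite Yw ?eqxx// => _; first by left.
    by right; split => //; exact/negP.
  case=> -[Bw ->]; first by rewrite ifT// one_neq.
  by rewrite ifF ?[-1 == 1]eq_sym ?one_neq//; exact/negP.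
rewrite YE errE; ring.
Qed.

Lemma signed_mean_regression (m : T -> R) B : is_regression P X Y m -> measurable B ->
  signed_mean \1_B = \int[P]_w (m (X w) * \1_B (X w)).
Proof.
move=> [mm im reg] mB.
have E (g : Omega -> R) : \int[P]_w (g w * \1_B (X w)) = \int[P]_(w in X @^-1` B) g w.
  rewrite [RHS]Rintegral_mkcond; apply: eq_Rintegral => w _.
  rewrite patchE indicE (_ : (w \in X @^-1` B) = (X w \in B)).
    by case: ifP; rewrite ?mulr1 ?mulr0.
  by apply/idP/idP => /set_mem Bw; exact/mem_set.
by rewrite /signed_mean !E /Rintegral reg.
Qed.

(** Among all indicators, that of [0 < m] maximises the product with [m]
pointwise. *)
Lemma bayes_optimal (m : T -> R) B : is_regression P X Y m -> measurable B ->
  signed_mean \1_B <= signed_mean \1_[set x | 0 < m x].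
Proof.
move=> regm mB; have [mm im _] := regm.
have mD : measurable [set x | 0 < m x] by exact: measurable_gt0.
have int_m E : measurable E -> P.-integrable setT (EFin \o (fun w => m (X w) * \1_E (X w))).
  move=> mE; apply: le_integrable im => //.
    by apply/measurable_EFinP; apply: measurable_funM; exact: measurableT_comp.
  move=> w _ /=; rewrite lee_fin normrM indicE ler_piMr//.
  by rewrite ger0_norm// lern1 leq_b1.
rewrite !(signed_mean_regression regm)//; apply: le_Rintegral => //; first exact: int_m.
  exact: int_m.
move=> w _; rewrite !indicE; have [m0|m0] := ltP 0 (m (X w)).
  rewrite [X in _ <= _ * X]/= (mem_set (m0 : [set x | 0 < m x] (X w))) mulr1.
  by rewrite ler_piMr ?(ltW m0)// lern1 leq_b1.
rewrite (@memNset _ [set x | 0 < m x]) ?mulr0; last by rewrite /= ltNge m0.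
by rewrite mulr_le0_ge0.
Qed.

End signed_mean.

(** * Independent families *)

Lemma product_rule {R : realType} {disp d' : measure_display}
    {Omega : measurableType disp} {T : measurableType d'} (P : probability Omega R)
    {I : choiceType} (G : I -> set (set Omega)) (n : nat) (idx : 'I_n -> I)
    (V : 'I_n -> Omega -> T) :
  mutually_independent P G -> injective idx ->
  (forall i, measurable_fun setT (V i)) ->
  (forall i B, measurable B -> G (idx i) (V i @^-1` B)) ->
  forall B : 'I_n -> set T, (forall i, measurable (B i)) ->
  P (\bigcap_i V i @^-1` B i) = (\prod_i fine (P (V i @^-1` B i)))%:E.
Proof.
move=> ind idx_inj mV GV B mB.
(* [E] extends the events from the image of [idx] to the whole index type. *)
pose E k := if [pick i | idx i == k] is Some i then V i @^-1` B i else setT.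
have EE i : E (idx i) = V i @^-1` B i.
  rewrite /E; case: pickP => [j /eqP/idx_inj ->//|/(_ i)]; by rewrite eqxx.
pose J := [fset idx i | i in 'I_n]%fset.
have := ind J E.
have -> : \bigcap_(i in [set` J]) E i = \bigcap_i V i @^-1` B i.
  apply/seteqP; split => w.
    by move=> Jw i _; rewrite -EE; apply: Jw; apply/imfsetP; exists i.
  by move=> Vw _ /= /imfsetP[i _ ->]; rewrite EE; exact: Vw.
move=> -> => [|k /imfsetP[i _ ->]]; last by rewrite EE; exact: GV.
rewrite big_imfset/=; last by move=> i j _ _; exact: idx_inj.
rewrite -prodEFin big_enum/=; apply: eq_bigr => i _.
rewrite EE fineK//; apply: fin_num_measure.
by rewrite -[X in measurable X]setTI; exact: mV.
Qed.

Section data.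
Context {R : realType} {d : nat} {disp : measure_display}.
Context {Omega : measurableType disp}.
Variables (P : probability Omega R) (X : {RV P >-> d.-tuple R}) (Y : {RV P >-> R}).
Variables (Xs : nat -> {RV P >-> d.-tuple R}) (Ys : nat -> {RV P >-> R}).
Variables (eps : nat -> nat -> {RV P >-> R}) (sigmaZ : R).
Hypothesis Y1 : forall w, Y w = 1 \/ Y w = -1.
Hypothesis Ys1 : forall i w, Ys i w = 1 \/ Ys i w = -1.
Hypothesis ident : forall (i : nat) (B : set (d.-tuple R * R)), measurable B ->
  P [set w | B (Xs i w, Ys i w)] = P [set w | B (X w, Y w)].
Hypothesis raw_indep : mutually_independent P (sigma_raw Xs Ys).
Hypothesis laplace : forall (i j : nat) (V : set R), measurable V ->
  distribution P (eps i j) V = laplace_prob V.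
Hypothesis noise_indep : mutually_independent P (sigma_noise eps).
Hypothesis sigmaZ0 : 0 < sigmaZ.

Lemma raw_subgaussian (A : set (d.-tuple R)) i : measurable A ->
  locally_subgaussian P (fun w => Ys i w * \1_A (Xs i w)) (signed_mean X Y \1_A)
    2 (1 / 2).
Proof.
move=> mA; pose Q y := [set w | A (Xs i w) /\ Ys i w = y].
have mQ y : measurable (Q y).
  rewrite (_ : Q y = (Xs i @^-1` A) `&` (Ys i @^-1` [set y])); last by [].
  by apply: measurableI; exact: measurable_funPTI.
have -> : signed_mean X Y \1_A = fine (P (Q 1)) - fine (P (Q (-1))).
  have PQ y : P (Q y) = P [set w | A (X w) /\ Y w = y].
    have -> : Q y = [set w | (A `*` [set y]) (Xs i w, Ys i w)] by [].
    by rewrite ident//; exact: measurableX.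
  by rewrite signed_mean_indic// !PQ.
rewrite (_ : (fun w => _) = fun w => \1_(Q 1) w - \1_(Q (-1)) w); last first.
  by apply/funext => w; exact: signed_indicE.
apply: signed_indic_subgaussian => //.
rewrite -subset0 => w [[_ Y1w] [_]]; rewrite Y1w => e; exfalso; lra.
Qed.

Lemma raw_deviation (A : set (d.-tuple R)) (n : nat) (t : R) : measurable A ->
  (0 < n)%N -> 0 < t <= 2 ->
  (P [set w | t <= `|n%:R^-1 * (\sum_(i < n) Ys i w * \1_A (Xs i w)) -
                     signed_mean X Y \1_A|]%R <=
   (2 * expR (- (n%:R * t ^+ 2 / (4 * 2))))%:E)%E.
Proof.
move=> mA n0 t2; pose V (i : 'I_n) w := Ys i w * \1_A (Xs i w).
have mg : measurable_fun setT (fun z : d.-tuple R * R => z.2 * \1_A z.1).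
  by apply: measurable_funM => //; apply: measurableT_comp => //; exact: measurable_indic.
have mXY i : measurable_fun setT (fun w => (Xs i w, Ys i w)).
  by apply: measurable_fun_pair; exact: measurable_funP.
have VE (i : 'I_n) B : V i @^-1` B =
    (fun w => (Xs i w, Ys i w)) @^-1` ((fun z : d.-tuple R * R => z.2 * \1_A z.1) @^-1` B).
  by [].
apply: (@mean_deviation _ _ _ P n V _ _ _ 2 (1 / 2)) => //.
- by move=> i; exact: (measurableT_comp mg (mXY i)).
- apply: (product_rule (idx := @nat_of_ord n) raw_indep) => //.
  + exact: val_inj.
  + by move=> i; exact: (measurableT_comp mg (mXY i)).
  + move=> i B mB; rewrite VE.
    exists ((fun z : d.-tuple R * R => z.2 * \1_A z.1) @^-1` B); last by rewrite setTI.
    by rewrite -[X in measurable X]setTI; exact: mg.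
- by move=> i; exact: raw_subgaussian.
- by move: t2 => /andP[-> t2]/=; lra.
Qed.

Lemma noise_deviation (j n : nat) (t : R) : (0 < n)%N -> 0 < t <= 2 * sigmaZ ->
  (P [set w | t <= `|n%:R^-1 * (\sum_(i < n) sigmaZ * eps i j w) - 0|]%R <=
   (2 * expR (- (n%:R * t ^+ 2 / (4 * sigmaZ ^+ 2))))%:E)%E.
Proof.
move=> n0 ts; pose V (i : 'I_n) w := sigmaZ * eps i j w.
have mg : measurable_fun setT (fun y : R => sigmaZ * y) by exact: measurable_funM.
apply: (@mean_deviation _ _ _ P n V _ _ _ (sigmaZ ^+ 2) sigmaZ^-1) => //.
- by move=> i; exact: measurable_funM.
- apply: (product_rule (idx := fun i : 'I_n => (nat_of_ord i, j)) noise_indep).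
  + by move=> i i' [/val_inj].
  + by move=> i; exact: measurable_funM.
  + move=> i B mB; exists ((fun y : R => sigmaZ * y) @^-1` B); last by rewrite setTI.
    by rewrite -[X in measurable X]setTI; exact: mg.
- by move=> i; apply: laplace_subgaussian => //; exact: laplace.
- by rewrite exprn_gt0.
- by rewrite expr2 mulrA mulfK ?gt_eqF.
Qed.

(** Both parts of the noisy average are locally sub-Gaussian, with constants [2]
and [sigmaZ ^ 2], here bounded by their sum. The factor [16] is the [4] of
Chernoff's bound times the [4] lost by halving the deviation. *)
Definition rate_const : R := (16 * (2 + sigmaZ ^+ 2))^-1.

Lemma rate_const_gt0 : 0 < rate_const.
Proof. by rewrite invr_gt0 mulr_gt0// ltr_wpDr ?sqr_ge0. Qed.

(** Half of the deviation is allotted to the raw average and half to the average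
of the noise. *)
Lemma nu_tilde_deviation (A : nat -> set (d.-tuple R)) (N : option nat) (n j : nat)
    (t : R) : measurable (A j) -> below N j -> (0 < n)%N -> 0 < t ->
  t <= 4 -> t <= 4 * sigmaZ ->
  (P [set w | t <= `|nu_tilde Xs Ys eps sigmaZ A N n j w - signed_mean X Y \1_(A j)|]%R <=
   (4 * expR (- (rate_const * (n%:R * t ^+ 2))))%:E)%E.
Proof.
move=> mA Nj n0 t0 t4 ts; have th : 0 < t / 2 by rewrite divr_gt0.
set nu := signed_mean _ _ _.
pose a w := n%:R^-1 * (\sum_(i < n) Ys i w * \1_(A j) (Xs i w)).
pose b w := n%:R^-1 * (\sum_(i < n) sigmaZ * eps i j w).
have nuE w : nu_tilde Xs Ys eps sigmaZ A N n j w = a w + b w.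
  rewrite /nu_tilde /a /b -mulrDr -big_split/=; congr (_ * _).
  by apply: eq_bigr => i _; rewrite /privatised Nj mulr1.
have ma : measurable_fun setT a.
  apply: measurable_funM => //; apply: measurable_sum => i _.
  by apply: measurable_funM => //; exact: measurableT_comp.
have mb : measurable_fun setT b.
  apply: measurable_funM => //; apply: measurable_sum => i _.
  exact: measurable_funM.
have b1 := raw_deviation mA n0 (t := t / 2).
have b2 := noise_deviation j n0 (t := t / 2).
apply: (@le_trans _ _ (P ([set w | t / 2 <= `|a w - nu|] `|` [set w | t / 2 <= `|b w - 0|])%R)).
  apply: le_measure; rewrite ?inE.
  - apply: (@measurable_norm_ge _ _ _ (fun w => nu_tilde Xs Ys eps sigmaZ A N n j w - nu)).
    apply: measurable_funB => //; rewrite (_ : nu_tilde _ _ _ _ _ _ _ _ = a \+ b).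
      exact: measurable_funD.
    by apply/funext => w; exact: nuE.
  - by apply: measurableU; apply: measurable_norm_ge; exact: measurable_funB.
  - move=> w /=; rewrite nuE => tle.
    have [ale|alt] := leP (t / 2) `|a w - nu|; [by left|right].
    rewrite leNgt; apply/negP => blt; move: tle; rewrite leNgt => /negP; apply.
    rewrite (_ : a w + b w - nu = (a w - nu) + (b w - 0)); last by ring.
    by apply: le_lt_trans (ler_normD _ _) _; rewrite (splitr t) ltrD.
apply: le_trans (measureU2 _ _ _) _.
- by apply: measurable_norm_ge; exact: measurable_funB.
- by apply: measurable_norm_ge; exact: measurable_funB.
apply: le_trans (leeD (b1 _) (b2 _)) _.
- by rewrite th/= ler_pdivrMr// (le_trans t4)//; lra.
- by rewrite th/= ler_pdivrMr//; move: ts; lra.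
have nt0 : 0 <= n%:R * t ^+ 2 by rewrite mulr_ge0// sqr_ge0.
have half (c : R) : 0 < c -> c <= 2 + sigmaZ ^+ 2 ->
    expR (- (n%:R * (t / 2) ^+ 2 / (4 * c))) <= expR (- (rate_const * (n%:R * t ^+ 2))).
  move=> c0 cs; rewrite ler_expR lerN2.
  rewrite (_ : n%:R * (t / 2) ^+ 2 / (4 * c) = (16 * c)^-1 * (n%:R * t ^+ 2)).
    rewrite ler_wpM2r// /rate_const lef_pV2 ?posrE ?mulr_gt0//; last exact: lt_le_trans cs.
    by rewrite ler_pM2l.
  by field; rewrite gt_eqF.
have s2 : 0 < sigmaZ ^+ 2 by rewrite exprn_gt0.
rewrite -EFinD lee_fin.
have h1 : 2 <= 2 + sigmaZ ^+ 2 by rewrite lerDl ltW.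
have h2 : sigmaZ ^+ 2 <= 2 + sigmaZ ^+ 2 by rewrite lerDr.
have := half 2 _ h1; have := half _ s2 h2.
by move=> e1 /(_ (ltr0n _ 2)) e2; lra.
Qed.

Lemma sigma_data_measurable I J : sigma_data Xs Ys eps I J `<=` measurable.
Proof.
apply: smallest_sub; first exact: sigma_algebra_measurable.
move=> E [[i _ [B mB <-]]|[ij _ [B mB <-]]].
  by apply: measurable_fun_pair.
by apply: measurable_funP.
Qed.

Lemma sigma_data_sub I J : sigma_data Xs Ys eps I J `<=` sigma_data Xs Ys eps setT setT.
Proof.
apply: sub_sigma_algebra2 => E [[i _ Ei]|[ij _ Eij]].
  by left; exists i.
by right; exists ij.
Qed.

Lemma nu_tilde_data (A : nat -> set (d.-tuple R)) (N : option nat) (n j : nat) V :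
  (forall j, measurable (A j)) -> measurable V ->
  sigma_data Xs Ys eps [set i | (i < n)%N] [set ij | (ij.1 < n)%N /\ below N ij.2]
    (nu_tilde Xs Ys eps sigmaZ A N n j @^-1` V).
Proof.
move=> mA mV; rewrite /sigma_data; set G0 := (X in <<s X >>).
pose D := g_sigma_algebraType G0.
suff mnu : measurable_fun setT (nu_tilde Xs Ys eps sigmaZ A N n j : D -> R).
  by have := mnu measurableT V mV; rewrite setTI.
apply: measurable_funM => //.
have [Nj|Nj] := boolP (below N j); last first.
  rewrite (_ : (fun _ => _) = cst 0)//; apply/funext => w.
  by rewrite big1// => i _; rewrite mulr0.
apply: measurable_sum => i _; apply: measurable_funM => //.
have raw B : measurable B -> G0.-sigma.-measurable ((fun w => (Xs i w, Ys i w)) @^-1` B).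
  move=> mB; apply: sub_sigma_algebra; left; exists (nat_of_ord i); first by rewrite /=.
  by exists B => //; rewrite setTI.
have mX : measurable_fun setT (Xs i : D -> d.-tuple R).
  move=> _ B mB; rewrite setTI.
  rewrite (_ : _ @^-1` _ = (fun w => (Xs i w, Ys i w)) @^-1` (B `*` setT)).
    by apply: raw; exact: measurableX.
  by apply/seteqP; split => w //= [].
have mY : measurable_fun setT (Ys i : D -> R).
  move=> _ B mB; rewrite setTI.
  rewrite (_ : _ @^-1` _ = (fun w => (Xs i w, Ys i w)) @^-1` (setT `*` B)).
    by apply: raw; exact: measurableX.
  by apply/seteqP; split => w //= [].
have me : measurable_fun setT (eps i j : D -> R).
  move=> _ B mB; apply: sub_sigma_algebra; right; exists (nat_of_ord i, j).
    by split => /=.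
  by exists B.
apply: measurable_funD; apply: measurable_funM => //.
apply: (measurableT_comp _ mX); exact: measurable_indic.
Qed.

End data.

(** * Consistency *)

Section domain.
Context {R : realType} {d : nat}.

Lemma euclid_norm_le_sqr (x : d.-tuple R) (K : R) : 0 <= K ->
  (euclid_norm x <= K) = (\sum_(k < d) tnth x k ^+ 2 <= K ^+ 2).
Proof.
move=> K0; have s0 : 0 <= \sum_(k < d) tnth x k ^+ 2.
  by apply: sumr_ge0 => k _; exact: sqr_ge0.
by rewrite -(ler_pXn2r (n := 2))// ?nnegrE ?sqrtr_ge0// sqr_sqrtr.
Qed.

Lemma measurable_euclid_ball (K : R) : 0 <= K ->
  measurable [set x : d.-tuple R | euclid_norm x <= K].
Proof.
move=> K0; rewrite (_ : [set x | _] =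
    [set x | \sum_(k < d) tnth x k ^+ 2 <= K ^+ 2]); last first.
  by apply/seteqP; split => x /=; rewrite euclid_norm_le_sqr.
rewrite -[X in measurable X]setTI.
apply: (@measurable_fun_le _ (d.-tuple R) R setT
  (fun x => \sum_(k < d) tnth x k ^+ 2) (cst (K ^+ 2))) => //.
apply: measurable_sum => k _.
exact: (@measurable_funX _ (d.-tuple R) R setT (fun x => tnth x k) 2
  (@measurable_tnth _ _ _ k)).
Qed.

Lemma ball_mass {disp : measure_display} {Omega : measurableType disp}
    (P : probability Omega R) (X : {RV P >-> d.-tuple R}) (del : R) : 0 < del ->
  exists2 K : R, 0 <= K & (P (X @^-1` (~` [set x | (euclid_norm x <= K)%R])) <= del%:E)%E.
Proof.
move=> del0; pose S (n : nat) := X @^-1` (~` [set x | euclid_norm x <= n%:R]).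
have mS n : measurable (S n).
  by apply: measurable_funPTI; apply: measurableC; exact: measurable_euclid_ball.
have : P \o S @ \oo --> P (\bigcap_n S n).
  apply: nonincreasing_cvg_mu => //.
  - by apply: le_lt_trans (ltry 1%R); apply: probability_le1; exact: mS.
  - exact: bigcapT_measurable.
  - move=> i j ij; apply/subsetPset => w /= nj ni; apply: nj.
    by apply: le_trans ni _; rewrite ler_nat.
have -> : \bigcap_n S n = set0.
  rewrite -subset0 => w wS; have := wS (Num.trunc (euclid_norm (X w))).+1 Logic.I.
  by apply => /=; apply: ltW; exact: truncnS_gt.
rewrite measure0 => /fine_cvgP[_ /cvgr_le/(_ _ del0)[N _ /(_ N (leqnn N))/= small]].
by exists N%:R => //; rewrite -[leLHS]fineK ?lee_fin//; apply: fin_num_measure; exact: mS.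
Qed.

Hypothesis d0 : (0 < d)%N.

(** A centred ball that contains a point of norm larger than [K] contains the
ball of radius [K]. *)
Lemma ball_sub_domain (S : nat -> set (d.-tuple R)) :
  (forall n, centred_ball (S n) \/ S n = setT) -> (forall n, S n `<=` S n.+1) ->
  \bigcup_n S n = setT -> forall K, 0 <= K ->
  \forall n \near \oo, [set x | euclid_norm x <= K] `<=` S n.
Proof.
move=> Sball Smono Scover K K0.
pose x0 : d.-tuple R := [tuple K + 1 | k < d].
have x0K : K < euclid_norm x0.
  apply: (@lt_le_trans _ _ (K + 1)); first by rewrite ltrDl.
  have K10 : 0 <= K + 1 by rewrite addr_ge0.
  rewrite -[K + 1]ger0_norm// -sqrtr_sqr ler_wsqrtr//.
  rewrite (bigD1 (Ordinal d0))//= tnth_mktuple lerDl sumr_ge0// => k _.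
  exact: sqr_ge0.
have [N _ SN] : (\bigcup_n S n) x0 by rewrite Scover.
exists N => // n /= Nn x /= xK.
have Sn : S n x0.
  by rewrite -(subnK Nn); elim: (n - N)%N => //= k IH; exact: Smono.
have [[r r0 [] SE]|->//] := Sball n; move: Sn; rewrite SE /= => x0r.
  by apply: le_lt_trans xK (lt_trans x0K x0r).
by apply: le_trans xK (le_trans (ltW x0K) x0r).
Qed.

Lemma cubic_cells (h : R) (C : set (set (d.-tuple R))) (A : nat -> set (d.-tuple R)) :
  cubic_partition h C -> set_bij setT C A ->
  [/\ forall j, measurable (A j), forall j, is_cube h (A j), trivIset setT A &
      forall x, exists j, A j x].
Proof.
move=> [[cC tC _] mC] [fA iA sA].
have CA j : C (A j) by exact: fA.
split.
- by move=> j; have [] := mC _ (CA j).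
- by move=> j; have [] := mC _ (CA j).
- move=> i j _ _ [x [Aix Ajx]]; apply: iA; rewrite ?inE//.
  by apply: tC => //; exists x.
- move=> x; have [c Cc cx] : cover C id x by rewrite cC.
  by have [j _ jc] := sA _ Cc; exists j; rewrite jc.
Qed.

End domain.

Lemma measure_bigsetU_le {R : realType} {d : measure_display} {T : measurableType d}
    (mu : {measure set T -> \bar R}) {I : eqType} (s : seq I) (F : I -> set T)
    (q : \bar R) : (forall i, measurable (F i)) ->
  (forall i, i \in s -> mu (F i) <= q)%E ->
  (mu (\big[setU/set0]_(i <- s) F i) <= \sum_(i <- s) q)%E.
Proof.
move=> mF; elim: s => [|i s IH] Fq; first by rewrite !big_nil measure0.
rewrite !big_cons; apply: le_trans (measureU2 _ _ _) _ => //.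
  exact: bigsetU_measurable.
apply: leeD; first by apply: Fq; rewrite mem_head.
by apply: IH => k ks; apply: Fq; rewrite inE ks orbT.
Qed.

Section consistency.
Context {R : realType} {d : nat} {disp : measure_display}.
Context {Omega : measurableType disp}.
Hypothesis d0 : (0 < d)%N.
Variables (P : probability Omega R) (X : {RV P >-> d.-tuple R}) (Y : {RV P >-> R}).
Variables (Xs : nat -> {RV P >-> d.-tuple R}) (Ys : nat -> {RV P >-> R}).
Variables (eps : nat -> nat -> {RV P >-> R}) (sigmaZ : R).
Hypothesis Y1 : forall w, Y w = 1 \/ Y w = -1.
Hypothesis Ys1 : forall i w, Ys i w = 1 \/ Ys i w = -1.
Hypothesis ident : forall (i : nat) (B : set (d.-tuple R * R)), measurable B ->
  P [set w | B (Xs i w, Ys i w)] = P [set w | B (X w, Y w)].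
Hypothesis raw_indep : mutually_independent P (sigma_raw Xs Ys).
Hypothesis laplace : forall (i j : nat) (V : set R), measurable V ->
  distribution P (eps i j) V = laplace_prob V.
Hypothesis noise_indep : mutually_independent P (sigma_noise eps).
Hypothesis sigmaZ0 : 0 < sigmaZ.
Variables (S : nat -> set (d.-tuple R)) (h : nat -> R).
Variables (A : nat -> nat -> set (d.-tuple R)) (N : nat -> option nat).
Hypothesis Sball : forall n, centred_ball (S n) \/ S n = setT.
Hypothesis Smono : forall n, S n `<=` S n.+1.
Hypothesis Scover : \bigcup_n S n = setT.
Hypothesis h0 : forall n, 0 < h n.
Hypothesis mA : forall n j, measurable (A n j).
Hypothesis cubeA : forall n j, is_cube (h n) (A n j).
Hypothesis tA : forall n, trivIset setT (A n).
Hypothesis cA : forall n x, exists j, A n j x.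
Hypothesis SN : forall n, cell_count (S n) (A n) (N n).
Hypothesis h_lim : h n @[n --> \oo] --> (0 : R).
Hypothesis h_rate : n%:R * h n ^+ (2 * d) / ln n%:R @[n --> \oo] --> +oo.

Let v n j w : R := nu_tilde Xs Ys eps sigmaZ (A n) (N n) n j w.

Let mv n j : measurable_fun setT (v n j).
Proof.
move=> _ V mV; rewrite setTI; apply: (@sigma_data_measurable _ _ _ _ P Xs Ys eps).
exact: nu_tilde_data.
Qed.

(** The probability that some cell meeting the ball deviates is at most the
number of these cells, of order [h ^ - d], times the tail bound
[4 exp (- a n h ^ (2 d))] of one cell. The assumption on [n h ^ (2 d) / ln n]
makes this summable. *)
Lemma cells_deviation (K tau : R) : 0 <= K -> 0 < tau -> tau <= 4 ->
  tau <= 4 * sigmaZ ->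
  {ae P, forall w, \forall n \near \oo, forall j,
    A n j `&` [set x | euclid_norm x <= K] !=set0 ->
    `|v n j w - signed_mean X Y \1_(A n j)| <= tau * h n ^+ d}.
Proof.
move=> K0 tau0 tau4 taus.
have /choice[s sP] n : exists s : seq nat, h n <= 1 -> [/\ uniq s,
    forall j, j \in s <-> A n j `&` [set x | euclid_norm x <= K] !=set0 &
    (size s)%:R * h n ^+ d <= packing_const (d := d) K].
  have [h1|h1] := leP (h n) 1; last by exists [::].
  have [|s ps] := @packing _ _ d0 (h n) K (A n) _ K0 (cubeA n) (@tA n).
    by rewrite h0.
  by exists s.
pose bad1 n j := [set w | tau * h n ^+ d <= `|v n j w - signed_mean X Y \1_(A n j)|].
have mbad1 n j : measurable (bad1 n j).
  by apply: measurable_norm_ge; exact: measurable_funB.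
pose bad n := \big[setU/set0]_(j <- s n) bad1 n j.
have mbad n : measurable (bad n) by exact: bigsetU_measurable.
have a0 : 0 < rate_const sigmaZ * tau ^+ 2 by rewrite mulr_gt0 ?rate_const_gt0 ?exprn_gt0.
have M0 := packing_const_gt0 (d := d) d0 K0.
have nbad : {ae P, forall w, \forall n \near \oo, ~ bad n w}.
  apply: (@ae_eventually_not _ _ _ P bad (4 * packing_const (d := d) K)) => //.
    by rewrite mulr_ge0// ltW.
  near=> n.
  have [n0 h1 rate] : [/\ (0 < n)%N, h n <= 1 & (h n ^+ d)^-1 *
      expR (- (rate_const sigmaZ * tau ^+ 2 * (n%:R * h n ^+ (2 * d)))) <= (n%:R ^+ 2)^-1].
    near: n; exact: near_rate.
  have KS : [set x | euclid_norm x <= K] `<=` S n.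
    near: n; exact: ball_sub_domain.
  have [us sE size_s] := sP n h1.
  have hd : 0 < h n ^+ d by rewrite exprn_gt0.
  have hd1 : h n ^+ d <= 1 by rewrite exprn_ile1 ?(ltW (h0 n)).
  pose q := expR (- (rate_const sigmaZ * (n%:R * (tau * h n ^+ d) ^+ 2))).
  have bad1P j : j \in s n -> (P (bad1 n j) <= (4 * q)%:E)%E.
    move=> /sE[x [Ax xK]]; apply: nu_tilde_deviation => //.
    - have [_ _ noS] := SN n; apply: contrapT => /negP /noS AS.
      suff : set0 x by [].
      by rewrite -AS; split => //; exact: KS.
    - by rewrite mulr_gt0.
    - by apply: le_trans tau4; rewrite ler_piMr// ltW.
    - by apply: le_trans taus; rewrite ler_piMr// ltW.
  apply: le_trans (measure_bigsetU_le (mbad1 n) bad1P) _.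
  rewrite sumEFin lee_fin big_const_seq count_predT iter_addr_0.
  rewrite -[leLHS]mulr_natr -!mulrA ler_pM2l//.
  have -> : q = expR (- (rate_const sigmaZ * tau ^+ 2 * (n%:R * h n ^+ (2 * d)))).
    by rewrite /q exprMn -exprM [(d * 2)%N]mulnC; congr (expR (- _)); ring.
  apply: le_trans (ler_wpM2l (ltW M0) rate).
  rewrite [leRHS]mulrA [leLHS]mulrC ler_wpM2r ?expR_ge0//.
  by rewrite -ler_pdivrMr ?invr_gt0// invrK.
apply: filterS nbad => w nbadw; near=> n.
have h1 : h n <= 1 by apply: ltW; near: n; move/cvgr_lt : h_lim; apply; exact: ltr01.
have nb : ~ bad n w by near: n; exact: nbadw.
move=> j Aj; have [_ sE _] := sP n h1.
rewrite leNgt; apply/negP => lt; apply: nb.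
by rewrite /bad -bigcup_seq; exists j; [exact/sE|exact: ltW].
Unshelve. all: by end_near. Qed.

Variable m : d.-tuple R -> R.
Hypothesis regm : is_regression P X Y m.

(** Four of the five [del] pay for the approximation of the Bayes set, its
oscillation on the cells and, twice, the mass outside a large ball; the last one
pays for the deviations in all the cells that meet the ball. *)
Lemma excess_signed_mean (del : R) : 0 < del ->
  {ae P, forall w, \forall n \near \oo,
    signed_mean X Y \1_[set x | 0 < m x] -
    signed_mean X Y \1_[set x | 0 < v n (pblock_index setT (A n) x) w] <= 5 * del}.
Proof.
move=> del0; have [mm _ _] := regm.
have mD : measurable [set x | 0 < m x] by exact: measurable_gt0.
have [_ /(_ _ del0)[f [mf f01 cf] fD]] := approximable_measurable (distribution P X) mD.
have [r r0 fr] := cf _ del0.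
have [K K0 massK] := ball_mass X del0.
have M0 := packing_const_gt0 (d := d) d0 K0.
pose M := packing_const (d := d) K.
(* The cost of all cells is at most [tau * M <= del]; the other two bounds put
[tau * h n ^+ d] in the range of Chernoff's bound. *)
pose tau := Num.min (del / M) (Num.min 4 (4 * sigmaZ)).
have tau0 : 0 < tau by rewrite !lt_min divr_gt0// mulr_gt0// ltr0n.
have tauM : tau * M <= del by rewrite -ler_pdivlMr// ge_min lexx.
have tau4 : tau <= 4 by rewrite !ge_min lexx orbT.
have taus : tau <= 4 * sigmaZ by rewrite !ge_min lexx !orbT.
apply: filterS (cells_deviation K0 tau0 tau4 taus) => w devw; near=> n.
have h1 : h n <= 1 by apply: ltW; near: n; move/cvgr_lt : h_lim; apply; exact: ltr01.
have hr : d%:R * h n <= r.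
  rewrite -ler_pdivlMl ?ltr0n// mulrC; apply: ltW.
  by near: n; move/cvgr_lt : h_lim; apply; rewrite divr_gt0// ltr0n.
have [|s [us sE size_s]] := @packing _ _ d0 (h n) K (A n) _ K0 (cubeA n) (@tA n).
  by rewrite h0.
have hd : 0 <= h n ^+ d by rewrite exprn_ge0// ltW.
apply: (@le_trans _ _ (4 * del + tau * h n ^+ d * (size s)%:R)).
  apply: (@plug_in_comparison _ _ _ _ _ P X Y Y1 _ f (A n) s (fun j => v n j w)) => //.
  - exact: ltW.
  - apply: le_trans fD; rewrite le_eqVlt; apply/orP; left; apply/eqP.
    rewrite ge0_integral_distribution//.
    by apply/measurable_EFinP; apply: measurableT_comp => //; exact: measurable_funB.
  - move=> j x y Ax Ay; apply: fr => k; apply: le_trans hr.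
    exact: (cube_diam d0 k (h0 n) (cubeA n j)).
  - apply: le_trans massK; apply: le_measure; rewrite ?inE.
    + apply: measurable_funPTI; apply: measurableC.
      by apply: bigcup_measurable => j _.
    + by apply: measurable_funPTI; apply: measurableC; exact: measurable_euclid_ball.
    + move=> w' /= nU Kw; apply: nU; have [j Aj] := cA n (X w').
      by exists j => //=; apply/sE; exists (X w').
  - move=> j /sE Aj; move: j Aj; near: n; exact: devw.
have : tau * ((size s)%:R * h n ^+ d) <= tau * M by rewrite ler_pM2l.
by move: tauM; lra.
Unshelve. all: by end_near. Qed.

End consistency.

Theorem theorem3 (R : realType) (d : nat) (hd : (1 <= d)%N)
    (disp : measure_display) (Omega : measurableType disp)
    (P : probability Omega R)
    (* the pair (X, Y) and the raw data *)
    (X : {RV P >-> d.-tuple R}) (Y : {RV P >-> R})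
    (Xs : nat -> {RV P >-> d.-tuple R}) (Ys : nat -> {RV P >-> R})
    (hY : forall w, Y w = 1 \/ Y w = -1)
    (hYs : forall i w, Ys i w = 1 \/ Ys i w = -1)
    (hident : forall (i : nat) (B : set (d.-tuple R * R)), measurable B ->
       P [set w | B (Xs i w, Ys i w)] = P [set w | B (X w, Y w)])
    (hraw : mutually_independent P (sigma_raw Xs Ys))
    (* the noise *)
    (eps : nat -> nat -> {RV P >-> R})
    (hlaplace : forall (i j : nat) (V : set R), measurable V ->
       distribution P (eps i j) V = laplace_prob V)
    (hnoise : mutually_independent P (sigma_noise eps))
    (hnoise_raw : independent P (sigma_data Xs Ys eps set0 setT)
                                (sigma_data Xs Ys eps setT set0))
    (htest : independent P (sigma_rv (fun w => (X w, Y w)))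
                           (sigma_data Xs Ys eps setT setT))
    (sigmaZ : R) (hsigmaZ : 0 < sigmaZ)
    (* the cubic partitions, the sets S_n and the numbering of the cells *)
    (C : R -> set (set (d.-tuple R)))
    (hC : forall h : R, 0 < h -> cubic_partition h (C h))
    (S : nat -> set (d.-tuple R))
    (hS : forall n, centred_ball (S n) \/ S n = setT)
    (hSmono : forall n, S n `<=` S n.+1)
    (hSlim : \bigcup_n S n = setT)
    (h : nat -> R) (hpos : forall n, 0 < h n)
    (A : nat -> nat -> set (d.-tuple R))
    (hA : forall n, set_bij setT (C (h n)) (A n))
    (N : nat -> option nat)
    (hN : forall n, cell_count (S n) (A n) (N n))
    (* the regression function and the conditional error probabilities *)
    (m : d.-tuple R -> R) (hm : is_regression P X Y m)
    (L : nat -> Omega -> R)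
    (hL : forall n, is_cond_prob P
       (sigma_data Xs Ys eps [set i | (i < n)%N]
          [set ij | (ij.1 < n)%N /\ below (N n) ij.2])
       [set w | classifier Xs Ys eps sigmaZ (A n) (N n) n w (X w) != Y w] (L n))
    (h_lim : h n @[n --> \oo] --> (0 : R))
    (h_rate : n%:R * h n ^+ (2 * d) / ln n%:R @[n --> \oo] --> +oo) :
  {ae P, forall w,
     L n w @[n --> \oo] --> error_prob P X Y (fun x => sign_pm (m x))}.
Proof.
have cells n := cubic_cells (hC _ (hpos n)) (hA n).
have mA n : forall j, measurable (A n j) by case: (cells n).
have tA n : trivIset setT (A n) by case: (cells n).
have cA n : forall x, exists j, A n j x by case: (cells n).
have cubeA n : forall j, is_cube (h n) (A n j) by case: (cells n).
pose rule n w x := classifier Xs Ys eps sigmaZ (A n) (N n) n w x.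
pose D := [set x | 0 < m x].
pose G n w := [set x | 0 < nu_tilde Xs Ys eps sigmaZ (A n) (N n) n
  (pblock_index setT (A n) x) w].
have mG n w : measurable (G n w).
  exact: (measurable_cellwise (fun j => nu_tilde Xs Ys eps sigmaZ (A n) (N n) n j w)).
have mD : measurable D.
  by have [mm _ _] := hm; exact: measurable_gt0.
have L_risk : {ae P, forall w, forall n, L n w = error_prob P X Y (rule n w)}.
  apply: ae_foralln => n; pose v j w := nu_tilde Xs Ys eps sigmaZ (A n) (N n) n j w.
  have data_measurable := @sigma_data_measurable _ _ _ _ P Xs Ys eps
    [set i | (i < n)%N] [set ij | (ij.1 < n)%N /\ below (N n) ij.2].
  have mv j V : measurable V -> sigma_data Xs Ys eps [set i | (i < n)%N]
      [set ij | (ij.1 < n)%N /\ below (N n) ij.2] (v j @^-1` V).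
    by move=> mV; exact: nu_tilde_data.
  have indep : independent P (sigma_rv (fun w => (X w, Y w)))
      (sigma_data Xs Ys eps [set i | (i < n)%N]
         [set ij | (ij.1 < n)%N /\ below (N n) ij.2]).
    by move=> E F XE /sigma_data_sub; exact: htest.
  apply: (cond_prob_unique data_measurable _ (hL n)).
    exact: (measurable_random_error data_measurable X hY (mA n) (tA n) (cA n) mv).
  exact: (error_prob_is_cond_prob data_measurable hY (mA n) (tA n) (cA n) indep mv).
have excess n w : error_prob P X Y (rule n w) -
    error_prob P X Y (fun x => sign_pm (m x)) =
    signed_mean X Y \1_D - signed_mean X Y \1_(G n w).
  rewrite (error_prob_signed_mean X hY mD) (error_prob_signed_mean X hY (mG n w)).
  by ring.
have small : {ae P, forall w, forall q, \forall n \near \oo,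
    signed_mean X Y \1_D - signed_mean X Y \1_(G n w) <= 5 * q.+1%:R^-1}.
  apply: ae_foralln => q; apply: (excess_signed_mean hd hY hYs hident hraw hlaplace
    hnoise hsigmaZ hS hSmono hSlim hpos mA cubeA tA cA hN h_lim h_rate hm).
  by rewrite invr_gt0.
apply: filterS2 L_risk small => w Lw small_w; apply/cvgrPdist_le => e e0.
have e5 : 0 < e / 5 by rewrite divr_gt0.
have [q qe] := ltr_add_invr e5.
rewrite add0r in qe.
near=> n; rewrite distrC Lw excess ger0_norm; last first.
  by rewrite subr_ge0; exact: bayes_optimal.
apply: (@le_trans _ _ (5 * q.+1%:R^-1)); first by near: n; exact: small_w.
by rewrite mulrC -ler_pdivlMr// ltW.
Unshelve. all: by end_near. Qed.
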